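(* Consider the multi-agent system $\dot x_i(t)=Ax_i(t)+Bu_i(t)$, $i\in\{1,\dots,N\}$, where the pair $(A,B)$ is stabilizable and the signed graph $\mathcal G=(\mathcal V,\mathcal E,\mathcal W)$ is connected and structurally balanced. Let $\kappa>0$ and let $P\in M_n(\mathbb R)$ be a (symmetric) positive definite matrix satisfying $A^TP+PA-\alpha(L)PBB^TP<-\kappa I_n$. Consider the event-triggered protocol $$u_i(t)=-K\sum_{j=1}^N|w_{ij}|\bigl(\hat x_i(t)-\mathrm{sgn}(w_{ij})\hat x_j(t)\bigr),\qquad K:=B^TP,$$ with triggering instants $t^i_0=0$ and $t^i_{k+1}=\inf\{t>t^i_k: f_i^k(t)>0\}$, where $f_i^k$ is the integral triggering function defined in the context, with constants $\beta_i>0$ such that $\beta_{\max}:=\max_i\beta_i$ satisfies, for some $c>0$ with $\beta:=\kappa-c\|L_D\otimes PBB^TP\|^2>0$, $$\beta_{\max}<\min\left\{\frac{1}{2\|L_D\|^2},\ \frac{\beta c}{2\|L_D\|^2(\beta c+1)}\right\}.$$ Then the system achieves bipartite consensus, i.e. $\lim_{t\to\infty}\|\sigma_ix_i(t)-\sigma_jx_j(t)\|=0$ for all $1\le i,j\le N$. Furthermore, the multi-agent system has a positive minimum inter-event time: there exists $\tau>0$ such that $t^i_{k+1}-t^i_k\ge\tau$ for every $i=1,\dots,N$ and $k\in\mathbb N$.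
   Context: Notation: $\mathbb N$ is the set of nonnegative integers; $\|\cdot\|$ is the Euclidean norm of vectors and the operator norm of matrices; $\otimes$ is the Kronecker product; $A\in M_n(\mathbb R)$, $B\in M_{n\times m}(\mathbb R)$; $x_i(t)\in\mathbb R^n$ and $u_i(t)\in\mathbb R^m$ are the state and control input of agent $i$. $(A,B)$ stabilizable means there is a matrix $K_1$ such that all eigenvalues of $A+BK_1$ have strictly negative real part. Graph: $\mathcal G=(\mathcal V,\mathcal E,\mathcal W)$ is an undirected signed graph with $\mathcal V=\{1,\dots,N\}$, $N\ge 2$, and symmetric signed weight matrix $\mathcal W=(w_{ij})\in M_N(\mathbb R)$, $w_{ij}\ne0$ iff $(j,i)\in\mathcal E$, $w_{ii}=0$. Its Laplacian is $L=C-\mathcal W$, $C=\mathrm{diag}(\sum_j|w_{1j}|,\dots,\sum_j|w_{Nj}|)$. $\mathcal G$ is structurally balanced if there is a bipartition $\mathcal V_1,\mathcal V_2$ of $\mathcal V$ with $w_{ij}\ge0$ for $i,j$ in the same part and $w_{ij}\le 0$ for $i,j$ in different parts. In that case (and $\mathcal G$ connected) fix $D=\mathrm{diag}(\sigma_1,\dots,\sigma_N)$, $\sigma_i\in\{1,-1\}$, such that all entries of $D\mathcal WD$ are nonnegative, and set $L_D:=DLD$. $\alpha(L)=\lambda_2(L)$ denotes the smallest positive eigenvalue of $L$. Event-triggered signals: agent $i$ has triggering instants $0=t^i_0\le t^i_1\le t^i_2\le\cdots$. For $t\ge 0$, $\hat x_i(t):=e^{(t-t^i_k)A}x_i(t^i_k)$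 where $t^i_k$ is the latest triggering instant of agent $i$ with $t^i_k\le t$. Put $z_i=\sigma_ix_i$, $\hat z_i=\sigma_i\hat x_i$, $e_{z,i}=\hat z_i-z_i$. Triggering rule: let $h:[0,\infty)\to(0,\infty)$ be a fixed continuous function with $\int_0^\infty h(s)\,ds=1$, and let $\beta_i>0$ be constants. Define $$g_i(s)=\|e_{z,i}(s)\|^2-\beta_i\Bigl\|\sum_{j=1}^N|w_{ij}|(\hat z_i(s)-\hat z_j(s))\Bigr\|^2-\beta_ih(s),\qquad f_i^k(t)=\int_{t^i_k}^tg_i(s)\,ds,$$ and $t^i_{k+1}:=\inf\{t>t^i_k: f_i^k(t)>0\}$. Here $f_i^k$ is evaluated along the signals generated with no further triggering of agent $i$ after $t_k^i$ (so $f_i^k\le0$ on $[t^i_k,t^i_{k+1})$); $\inf\emptyset=+\infty$, in which case agent $i$ has no further triggering instants, and statements about $t^i_k$ concern indices with $t^i_k<\infty$. The states $x_i$ are continuous and satisfy the differential equation between triggering instants, with arbitrary initial states. *)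

(* Defs.v *)
Set Warnings "-notation-overridden,-notation-incompatible-prefix".
From HB Require Import structures.
From mathcomp Require Import all_boot all_order all_algebra.
From mathcomp Require Import all_classical all_reals all_analysis.
From mathcomp Require Import mxtens complex.

Set Implicit Arguments.
Unset Strict Implicit.
Unset Printing Implicit Defensive.

Import Order.TTheory GRing.Theory Num.Theory.
Import numFieldNormedType.Exports.

Local Open Scope classical_set_scope.
Local Open Scope ring_scope.

(* The library norm on matrices is the entrywise sup norm, hence l2norm and
   opnorm. *)
Definition l2norm (R : realType) (n : nat) (v : 'cV[R]_n) : R :=
  Num.sqrt (\sum_i v i 0 ^+ 2).

Definition opnorm (R : realType) (m n : nat) (M : 'M[R]_(m, n)) : R :=
  sup [set l2norm (M *m v) | v in [set v : 'cV[R]_n | l2norm v <= 1]].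

Definition mxexp (R : realType) (n : nat) (A : 'M[R]_n) : 'M[R]_n :=
  lim (series (fun k => k`!%:R^-1 *: A ^+ k) @ \oo).

Definition posdefmx (R : realType) (n : nat) (M : 'M[R]_n) : Prop :=
  M^T = M /\ forall v : 'cV[R]_n, v != 0 -> 0 < (v^T *m M *m v) 0 0.

Definition stabilizable (R : realType) (n m : nat)
    (A : 'M[R]_n) (B : 'M[R]_(n, m)) : Prop :=
  exists K1 : 'M[R]_(m, n), forall a : R[i],
    eigenvalue (map_mx (real_complex R) (A + B *m K1)) a -> complex.Re a < 0.

(* A signed graph on 'I_N is given by its weight matrix: (j, i) is an edge iff
   W i j != 0. *)
Definition signed_graph (R : realType) (N : nat) (W : 'M[R]_N) : Prop :=
  W^T = W /\ forall i, W i i = 0.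

Definition graph_connected (R : realType) (N : nat) (W : 'M[R]_N) : Prop :=
  forall i j, connect [rel a b | W a b != 0] i j.

Definition structurally_balanced (R : realType) (N : nat) (W : 'M[R]_N) : Prop :=
  exists V1 : {set 'I_N}, forall i j,
    if (i \in V1) == (j \in V1) then 0 <= W i j else W i j <= 0.

Definition laplacian (R : realType) (N : nat) (W : 'M[R]_N) : 'M[R]_N :=
  diag_mx (\row_i \sum_j `|W i j|) - W.

Definition smallest_pos_eigenvalue (R : realType) (N : nat)
    (M : 'M[R]_N) (a : R) : Prop :=
  [/\ 0 < a, eigenvalue M a &
      forall b, 0 < b -> eigenvalue M b -> a <= b].

Definition gauge_mx (R : realType) (N : nat) (sigma : 'I_N -> R) : 'M[R]_N :=
  diag_mx (\row_i sigma i).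

Definition gauged_laplacian (R : realType) (N : nat)
    (W : 'M[R]_N) (sigma : 'I_N -> R) : 'M[R]_N :=
  gauge_mx sigma *m laplacian W *m gauge_mx sigma.

(* T i k is the k-th triggering instant of agent i, and +oo when there is no
   such instant. *)
Definition instants (R : realType) (N : nat) := 'I_N -> nat -> \bar R.

Definition signal (R : realType) (N n : nat) := 'I_N -> R -> 'cV[R]_n.

(* The signals live on [0, lifetime T[, the set of times before which no agent
   has infinitely many triggering instants; they are not assumed to exist past
   a Zeno time. A positive lower bound on all inter-event times forces
   lifetime T = +oo. *)
Definition lifetime (R : realType) (N : nat) (T : instants R N) : \bar R :=
  ereal_inf [set ereal_sup (range (T i)) | i in [set: 'I_N]].

Definition last_instant (R : realType) (T : nat -> \bar R) (t : R) : R :=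
  fine (ereal_sup [set T k | k in [set k | (T k <= t%:E)%E]]).

Definition xhat (R : realType) (N n : nat) (A : 'M[R]_n)
    (T : instants R N) (x : signal R N n) : signal R N n :=
  fun i t => let s := last_instant (T i) t in
    mxexp ((t - s) *: A) *m x i s.

Definition control (R : realType) (N n m : nat) (A : 'M[R]_n)
    (K : 'M[R]_(m, n)) (W : 'M[R]_N) (T : instants R N) (x : signal R N n)
    (i : 'I_N) (t : R) : 'cV[R]_m :=
  - (K *m \sum_j `|W i j| *:
       (xhat A T x i t - Num.sg (W i j) *: xhat A T x j t)).

(* Closed-loop signals for prescribed instants T; they are determined by T and
   the initial states. *)
Definition trajectory (R : realType) (N n m : nat) (A : 'M[R]_n)
    (B : 'M[R]_(n, m)) (K : 'M[R]_(m, n)) (W : 'M[R]_N)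
    (T : instants R N) (x : signal R N n) : Prop :=
  forall i,
    {within [set t | 0 <= t /\ (t%:E < lifetime T)%E], continuous (x i)} /\
    (forall t : R, 0 < t -> (t%:E < lifetime T)%E ->
      (forall j k, T j k != t%:E) ->
      is_derive t 1 (x i) (A *m x i t + B *m control A K W T x i t)).

Definition trig_g (R : realType) (N n : nat) (A : 'M[R]_n) (W : 'M[R]_N)
    (sigma beta : 'I_N -> R) (h : R -> R) (T : instants R N)
    (x : signal R N n) (i : 'I_N) (s : R) : R :=
  let zhat j := sigma j *: xhat A T x j s in
  let e := zhat i - sigma i *: x i s in
  l2norm e ^+ 2
  - beta i * l2norm (\sum_j `|W i j| *: (zhat i - zhat j)) ^+ 2
  - beta i * h s.

Definition trig_f (R : realType) (N n : nat) (A : 'M[R]_n) (W : 'M[R]_N)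
    (sigma beta : 'I_N -> R) (h : R -> R) (T : instants R N)
    (x : signal R N n) (i : 'I_N) (k : nat) (t : R) : R :=
  \int[lebesgue_measure]_(s in `[fine (T i k), t])
    trig_g A W sigma beta h T x i s.

Definition stop_after (R : realType) (N : nat) (T : instants R N)
    (i : 'I_N) (k : nat) : instants R N :=
  fun j l => if (j == i) && (k < l)%N then +oo%E else T j l.

(* The signals y are those generated, from the same initial states, with no
   triggering of agent i after T i k and the other agents' instants kept. They
   agree with x up to T i k.+1; past that instant they matter only through
   their right germ, which decides whether trig_f becomes positive there.
   When T i k = +oo, the set below is empty and T i k.+1 = +oo. *)
Definition event_triggered (R : realType) (N n m : nat) (A : 'M[R]_n)
    (B : 'M[R]_(n, m)) (K : 'M[R]_(m, n)) (W : 'M[R]_N)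
    (sigma beta : 'I_N -> R) (h : R -> R)
    (T : instants R N) (x : signal R N n) : Prop :=
  [/\ trajectory A B K W T x,
      forall i, T i 0%N = 0%E &
      forall i k, let T' := stop_after T i k in
        exists y : signal R N n,
          [/\ trajectory A B K W T' y,
              forall j, y j 0 = x j 0 &
              T i k.+1 = ereal_inf [set t%:E | t in
                [set t : R | [/\ (T i k < t%:E)%E, (t%:E < lifetime T')%E &
                   0 < trig_f A W sigma beta h T' y i k t]]]]].

Definition bipartite_consensus (R : realType) (N n : nat)
    (sigma : 'I_N -> R) (x : signal R N n) : Prop :=
  forall i j,
    (fun t : R => l2norm (sigma i *: x i t - sigma j *: x j t)) @ +oo --> (0 : R).

Definition positive_MIET (R : realType) (N : nat) (T : instants R N) : Prop :=
  exists2 tau : R, 0 < tau &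
    forall i k, (T i k < +oo)%E -> (tau%:E <= T i k.+1 - T i k)%E.

(* Main.v *)
Require Import Defs.
From mathcomp Require Import all_boot all_order all_algebra.
From mathcomp Require Import all_classical all_reals all_analysis.
From mathcomp Require Import measurable_realfun mxtens ring lra.
Import Order.TTheory GRing.Theory Num.Theory.
Import numFieldNormedType.Exports.

Set Implicit Arguments.
Unset Strict Implicit.
Unset Printing Implicit Defensive.

Local Open Scope classical_set_scope.
Local Open Scope ring_scope.

(** In the gauged states z_i = sigma_i x_i the signed Laplacian becomes the
    ordinary Laplacian L_D of the weights |w_ij|, and the closed loop reads
    z' = A z - B K (L_D zhat), where zhat = z + e and e is the sampling error.
    Throughout, the states are the columns of an n x N matrix, so that L_D acts
    by right multiplication.

    Inter-event times. Between two instants of agent i its error satisfies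
    e_i' = A e_i + B K q_i with e_i = 0 initially, where q_i is the i-th column
    of L_D zhat. Hence over a short time t the integral of |e_i|^2 is at most a
    constant times t times the integral of |q_i|^2 (sampling_error), and for t
    below a uniform tau it is smaller than the beta_i-multiple allowed by the
    triggering rule (no_early_trigger, min_inter_event). In particular there is
    no Zeno time and all signals exist forever (event_lifetime).

    Consensus. The triggering functions are defined along auxiliary signals in
    which agent i stops triggering; these agree with the actual ones up to the
    next instant by uniqueness of the closed loop (trajectory_unique). Adding
    up over the inter-event intervals bounds the integral of |e|^2 by beta_max
    times that of |L_D zhat|^2 plus a constant (agent_budget, network_budget).
    With D the matrix of deviations from the average, V = <D, P D> satisfies
    V' <= - bet |D|^2 + |e|^2 / c (lyapunov_decay): the spectral gap of L_D,
    obtained by minimising its Rayleigh quotient over the zero-sum unit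
    vectors, turns the Riccati inequality into decay. The smallness of beta_max
    closes the loop between these two estimates, so |D|^2 and |e|^2 are both
    integrable over all times (energy_bounded). Since the derivative of |D|^2
    is bounded by a multiple of |D|^2 + |e|^2, the value |D(t)|^2 is bounded by
    a multiple of the integral of |D|^2 + |e|^2 over [t - 1, t], which tends to
    zero (disagreement_le, disagreement_vanishes). *)

(** * Piecewise smooth functions *)

Section PiecewiseSmooth.
Context {R : realType}.
Implicit Types (f g df dg : R -> R) (s : seq R) (a b t : R).
Notation mu := (@lebesgue_measure R).

(** Closed-loop signals fail to be differentiable at the triggering instants;
    on a bounded interval these are the finitely many exceptions s. *)
Definition pw_derive s a b f df : Prop :=
  {within `[a, b], continuous f} /\
  forall t, a < t < b -> t \notin s -> is_derive t 1 f (df t).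

(** The regularity of sampled signals, which jump at the exceptions; nothing is
    asked of the one-sided limits there, only boundedness. *)
Definition pw_continuous s a b g : Prop :=
  (forall t, a < t < b -> t \notin s -> {for t, continuous g}) /\
  exists M, forall t, a <= t <= b -> `|g t| <= M.

Lemma within_itvW a b c d (V : topologicalType) (f : R -> V) : a <= c -> d <= b ->
  {within `[a, b], continuous f} -> {within `[c, d], continuous f}.
Proof.
move=> ac db; apply: continuous_subspaceW => t /=; rewrite !in_itv/= => /andP[ct td].
by rewrite (le_trans ac ct) (le_trans td db).
Qed.

Lemma pw_deriveW s a b c d f df : a <= c -> d <= b ->
  pw_derive s a b f df -> pw_derive s c d f df.
Proof.
move=> ac db [cf dfP]; split; first exact: within_itvW cf.
by move=> t /andP[ct td] ts; apply: dfP => //; rewrite (le_lt_trans ac ct) (lt_le_trans td db).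
Qed.

Lemma pw_continuousW s a b c d g : a <= c -> d <= b ->
  pw_continuous s a b g -> pw_continuous s c d g.
Proof.
move=> ac db [cf [M HM]]; split.
  by move=> t /andP[ct td] ts; apply: cf => //; rewrite (le_lt_trans ac ct) (lt_le_trans td db).
by exists M => t /andP[ct td]; apply: HM; rewrite (le_trans ac ct) (le_trans td db).
Qed.

(** By continuity, an interval can be cut at the exceptions, and the mean value
    theorem applies to each piece. *)
Lemma pw_derive_nincr s a b f df : a <= b -> pw_derive s a b f df ->
  (forall t, a < t < b -> t \notin s -> df t <= 0) -> f b <= f a.
Proof.
elim: s a b => [|c s IH] a b ab [cf dfP] df0.
  apply: (@ler0_derive1_le_cc _ f a b) => //.
  - by move=> t; rewrite in_itv/= => tab; have [] := dfP t tab isT.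
  - move=> t; rewrite in_itv/= => tab; rewrite derive1E.
    by rewrite (@derive_val _ _ _ _ _ _ _ (dfP t tab isT)); exact: df0.
  - by rewrite in_itv/= lexx ab.
  - by rewrite in_itv/= lexx ab.
have [/andP[ac cb]|cab] := boolP (a < c < b); last first.
  have inE t : a < t < b -> t \notin s -> t \notin c :: s.
    move=> tab ts; rewrite inE negb_or ts andbT.
    by apply/negP => /eqP tc; rewrite -tc tab in cab.
  apply: IH => //; first by split => // t tab ts; apply: dfP => //; exact: inE.
  by move=> t tab ts; apply: df0 => //; exact: inE.
have fbc : f b <= f c.
  apply: IH; [exact: ltW| |].
  - split; first by apply: within_itvW cf => //; exact: ltW.
    move=> t /andP[ct tb] ts; apply: dfP; first by rewrite (lt_trans ac ct).
    by rewrite inE negb_or ts (gt_eqF ct).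
  - move=> t /andP[ct tb] ts; apply: df0; first by rewrite (lt_trans ac ct).
    by rewrite inE negb_or ts (gt_eqF ct).
apply: (le_trans fbc); apply: IH; [exact: ltW| |].
- split; first by apply: within_itvW cf => //; exact: ltW.
  move=> t /andP[act tc] ts; apply: dfP; first by rewrite act (lt_trans tc).
  by rewrite inE negb_or ts (lt_eqF tc).
- move=> t /andP[act tc] ts; apply: df0; first by rewrite act (lt_trans tc).
  by rewrite inE negb_or ts (lt_eqF tc).
Qed.

Lemma pw_derive_cst s a b (r : R) : pw_derive s a b (cst r) (cst 0).
Proof. by split => [x|t _ _]; [exact: cst_continuous|exact: is_derive_cst]. Qed.

Lemma pw_deriveD s a b f df g dg : pw_derive s a b f df -> pw_derive s a b g dg ->
  pw_derive s a b (fun t => f t + g t) (fun t => df t + dg t).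
Proof.
move=> [cf fP] [cg gP]; split.
  by move=> x; apply: (@continuousD _ _ (subspace _)); [exact: cf|exact: cg].
by move=> t tab ts; apply: is_deriveD; [exact: fP|exact: gP].
Qed.

Lemma pw_deriveZ s a b (r : R) f df : pw_derive s a b f df ->
  pw_derive s a b (fun t => r * f t) (fun t => r * df t).
Proof.
move=> [cf fP]; split.
  by move=> x; apply: (@continuousM _ (subspace _)); [exact: cst_continuous|exact: cf].
by move=> t tab ts; exact: (@is_deriveZ _ _ _ f r t 1 _ (fP t tab ts)).
Qed.

Lemma pw_deriveB s a b f df g dg : pw_derive s a b f df -> pw_derive s a b g dg ->
  pw_derive s a b (fun t => f t - g t) (fun t => df t - dg t).
Proof.
move=> fP /(pw_deriveZ (-1)) gP; have := pw_deriveD fP gP.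
by under eq_fun do rewrite mulN1r; under [X in pw_derive _ _ _ _ X]eq_fun do rewrite mulN1r.
Qed.

Lemma pw_deriveM s a b f df g dg : pw_derive s a b f df -> pw_derive s a b g dg ->
  pw_derive s a b (fun t => f t * g t) (fun t => df t * g t + f t * dg t).
Proof.
move=> [cf fP] [cg gP]; split.
  by move=> x; apply: (@continuousM _ (subspace _)); [exact: cf|exact: cg].
move=> t tab ts; have := is_deriveM (fP t tab ts) (gP t tab ts).
rewrite /GRing.scale/= addrC (mulrC (g t)) => H; exact: H.
Qed.

Lemma pw_derive_sum s a b (I : finType) (f df : I -> R -> R) :
  (forall i, pw_derive s a b (f i) (df i)) ->
  pw_derive s a b (fun t => \sum_i f i t) (fun t => \sum_i df i t).
Proof.
move=> fP.
suff H r : pw_derive s a b (fun t => \sum_(i <- r) f i t) (fun t => \sum_(i <- r) df i t).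
  exact: H.
elim: r => [|i r IH].
  under eq_fun do rewrite big_nil; under [X in pw_derive _ _ _ _ X]eq_fun do rewrite big_nil.
  exact: pw_derive_cst.
under eq_fun do rewrite big_cons; under [X in pw_derive _ _ _ _ X]eq_fun do rewrite big_cons.
exact: pw_deriveD.
Qed.

Lemma eq_pw_derive s a b f df f' df' : (forall t, f t = f' t) ->
  (forall t, a < t < b -> t \notin s -> df t = df' t) ->
  pw_derive s a b f df -> pw_derive s a b f' df'.
Proof.
move=> /funext <- dfE [cf fP]; split => // t tab ts.
by rewrite -dfE//; exact: fP.
Qed.

(** All integral estimates are derived from this comparison principle, applied
    to primitives. *)
Lemma pw_derive_le s a b f df g dg : a <= b ->
  pw_derive s a b f df -> pw_derive s a b g dg ->
  (forall t, a < t < b -> t \notin s -> df t <= dg t) -> f b - f a <= g b - g a.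
Proof.
move=> ab fP gP dle.
suff : f b - g b <= f a - g a by lra.
apply: (pw_derive_nincr ab (pw_deriveB fP gP)) => t tab ts.
by rewrite subr_le0 dle.
Qed.

Lemma pw_continuous_cst s a b (r : R) : pw_continuous s a b (cst r).
Proof. by split=> [t _ _|]; [exact: cst_continuous|exists `|r|]. Qed.

Lemma pw_continuousD s a b f g : pw_continuous s a b f -> pw_continuous s a b g ->
  pw_continuous s a b (fun t => f t + g t).
Proof.
move=> [cf [M HM]] [cg [M' HM']]; split.
  by move=> t tab ts; apply: continuousD; [exact: cf|exact: cg].
exists (M + M') => t tab; apply: (le_trans (ler_normD _ _)).
by rewrite lerD ?HM ?HM'.
Qed.

Lemma pw_continuousM s a b f g : pw_continuous s a b f -> pw_continuous s a b g ->
  pw_continuous s a b (fun t => f t * g t).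
Proof.
move=> [cf [M HM]] [cg [M' HM']]; split.
  by move=> t tab ts; apply: continuousM; [exact: cf|exact: cg].
by exists (M * M') => t tab; rewrite normrM ler_pM ?HM ?HM'.
Qed.

Lemma pw_continuousZ s a b (r : R) f : pw_continuous s a b f ->
  pw_continuous s a b (fun t => r * f t).
Proof. by move=> fP; apply: pw_continuousM => //; exact: pw_continuous_cst. Qed.

Lemma pw_continuousB s a b f g : pw_continuous s a b f -> pw_continuous s a b g ->
  pw_continuous s a b (fun t => f t - g t).
Proof.
move=> fP /(pw_continuousZ (-1)) gP; have := pw_continuousD fP gP.
by under eq_fun do rewrite mulN1r.
Qed.

Lemma pw_continuous_sum s a b (I : finType) (f : I -> R -> R) :
  (forall i, pw_continuous s a b (f i)) -> pw_continuous s a b (fun t => \sum_i f i t).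
Proof.
move=> fP; suff H r : pw_continuous s a b (fun t => \sum_(i <- r) f i t) by exact: H.
elim: r => [|i r IH]; first by under eq_fun do rewrite big_nil; exact: pw_continuous_cst.
by under eq_fun do rewrite big_cons; exact: pw_continuousD.
Qed.

Lemma within_continuous_bounded a b f : {within `[a, b], continuous f} ->
  exists M, forall t, a <= t <= b -> `|f t| <= M.
Proof.
move=> cf; have [ab|ba] := leP a b; last first.
  by exists 0 => t /andP[at_ tb]; have := le_trans at_ tb; rewrite leNgt ba.
have [c _ Hc] := EVT_max ab cf; have [d _ Hd] := EVT_min ab cf.
exists (`|f c| + `|f d|) => t tab; have tI : t \in `[a, b]%R by rewrite in_itv.
have := Hc t tI; have := Hd t tI; have := ler_norm (f c); have := ler_norm (- f d).
rewrite normrN ler_norml; have := normr_ge0 (f c); have := normr_ge0 (f d).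
by move=> *; apply/andP; split; lra.
Qed.

Lemma within_pw_continuous s a b g : {within `[a, b], continuous g} -> pw_continuous s a b g.
Proof.
move=> cf; split; last exact: within_continuous_bounded.
move=> t /andP[at_ tb] ts; have ab : a < b := lt_trans at_ tb.
have /(continuous_within_itvP _ ab)[H _ _] := cf.
by apply: H; rewrite in_itv/= at_ tb.
Qed.

(** Up to the finite set of exceptions and endpoints, the function is
    continuous on an open set, hence measurable; and it is bounded. *)
Lemma pw_continuous_integrable s a b g : pw_continuous s a b g ->
  mu.-integrable `[a, b] (EFin \o g).
Proof.
move=> [cg [M HM]].
apply: measurable_bounded_integrable => //.
- rewrite /= lebesgue_measure_itv/=; case: ifP => _; by rewrite -?EFinD ltry.
- pose U := `]a, b[ `\` [set` s].
  have sfin : finite_set [set` s] by exact: finite_seq.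
  have sclosed : closed [set` s].
    have acc : accessible_space R by exact/hausdorff_accessible/Rhausdorff.
    by have := sfin; apply: (proj1 accessible_finite_set_closed acc).
  have oU : open U.
    by rewrite /U setDE; apply: openI; [exact: interval_open|exact: closed_openC].
  pose F := [set` [:: a, b & s]].
  have mF : measurable F.
    apply: countable_measurable; first by move=> t; exact: measurable_set1.
    by apply: finite_set_countable; exact: finite_seq.
  have sub : `[a, b] `<=` U `|` F.
    move=> t /=; rewrite in_itv/= => /andP[at_ tb].
    have [tF|tF] := boolP (t \in [:: a, b & s]); [right|left] => //.
    move: tF; rewrite !inE !negb_or => /and3P[ta tb' ts]; split; last exact/negP.
    by rewrite /= in_itv/= !lt_neqAle at_ tb (eq_sym a) ta tb'.
  apply: measurable_funS sub _; first by apply: measurableU => //; exact: open_measurable.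
  apply/measurable_funU => //; first exact: open_measurable.
  split.
    apply: subspace_continuous_measurable_fun; first exact: open_measurable.
    apply: continuous_in_subspaceT => t; rewrite inE => -[/=]; rewrite in_itv/= => tab ts.
    by apply: cg => //; exact/negP.
  move=> _ Y mY; apply: countable_measurable; first by move=> t; exact: measurable_set1.
  apply: (@sub_countable _ _ _ F); first by apply: subset_card_le; exact: subIsetl.
  by apply: finite_set_countable; exact: finite_seq.
- exists M; split; first exact: num_real.
  move=> M' MM' t /=; rewrite in_itv/= => /HM gM.
  by apply: (le_trans gM); exact: ltW.
Qed.

Definition primitive a g (t : R) : R := \int[mu]_(r in `[a, t]) g r.

Lemma primitive_start a g : primitive a g a = 0.
Proof. by rewrite /primitive set_itv1 Rintegral_set1. Qed.

Lemma pw_derive_primitive s a b g : a <= b -> pw_continuous s a b g ->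
  pw_derive s a b (primitive a g) g.
Proof.
move=> ab gP; have ig := pw_continuous_integrable gP; split.
  exact: parameterized_integral_continuous.
move=> t /andP[at_ tb] ts; have cgt : {for t, continuous g} by apply: gP.1 => //; rewrite at_ tb.
have [D1 D2] := continuous_FTC1_closed tb ig at_ cgt.
by rewrite -D2 derive1E; exact: derivableP.
Qed.

Lemma Rintegral_primitive s a b c t g : pw_continuous s a b g -> a <= c -> c <= t -> t <= b ->
  \int[mu]_(r in `[c, t]) g r = primitive a g t - primitive a g c.
Proof.
move=> gP ac ct tb.
have gP' : pw_continuous s a t g by exact: pw_continuousW gP.
have gP'' : pw_continuous s c t g by exact: pw_continuousW gP'.
rewrite /primitive Rintegral_itvB//; last exact: pw_continuous_integrable gP'.
rewrite Rintegral_itv_obnd_cbnd//.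
apply: integrableS (pw_continuous_integrable gP'') => //.
by apply: subset_itvr; rewrite bnd_simp.
Qed.

End PiecewiseSmooth.

(** * The matrix exponential *)

Section MatrixExponential.
Context {R : realType} {n : nat}.
Implicit Types (A M : 'M[R]_n) (t : R).

Lemma cvg_mx_entries (p q : nat) (U : nat -> 'M[R]_(p, q)) (L : 'M[R]_(p, q)) :
  (forall i j, (fun k => U k i j) @ \oo --> L i j) -> U @ \oo --> L.
Proof.
move=> UL; apply/cvgrPdist_le => /= e e0; near=> k.
rewrite [leLHS]/Num.Def.normr/= mx_normrE (bigmax_le _ (ltW e0))//= => i _.
rewrite !mxE; move: i; near: k; apply: filter_forall => /= i.
exact: ((cvgrPdist_le _ _).1 (UL i.1 i.2)).
Unshelve. all: by end_near. Qed.

Lemma cvgn_sum (I : finType) (u : I -> nat -> R) (l : I -> R) :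
  (forall i, u i @ \oo --> l i) -> (fun k => \sum_i u i k) @ \oo --> \sum_i l i.
Proof.
move=> ul; suff H r : (fun k => \sum_(i <- r) u i k) @ \oo --> \sum_(i <- r) l i by exact: H.
elim: r => [|i r IH].
  by rewrite big_nil; under eq_fun do rewrite big_nil; exact: cvg_cst.
by rewrite big_cons; under eq_fun do rewrite big_cons; exact: cvgD.
Qed.

(** The power series of the entries of M e^(tA): letting M vary makes this
    family of coefficients closed under termwise differentiation. *)
Definition mxexp_coeff M A i j (k : nat) : R := (M *m A ^+ k) i j / k`!%:R.

Lemma normr_mxpow_le A k i j :
  `|(A ^+ k) i j| <= (\sum_a \sum_b `|A a b|) ^+ k.
Proof.
elim: k i j => [|k IH] i j.
  by rewrite !expr0 mxE; case: eqP => _; rewrite ?normr1 ?normr0.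
rewrite !exprS mxE; apply: (le_trans (ler_norm_sum _ _ _)).
set K := \sum_a _.
apply: (@le_trans _ _ (\sum_l `|A i l| * K ^+ k)).
  by apply: ler_sum => l _; rewrite normrM ler_wpM2l.
rewrite -mulr_suml ler_wpM2r//.
  by rewrite exprn_ge0// sumr_ge0// => a _; rewrite sumr_ge0.
rewrite /K [leRHS](bigD1 i)//= lerDl sumr_ge0// => a _; exact: sumr_ge0.
Qed.

Lemma is_cvg_mxexp_coeff M A i j t : cvgn (pseries (mxexp_coeff M A i j) t).
Proof.
pose K : R := \sum_a \sum_b `|A a b|.
pose L : R := \sum_b `|M i b|.
have K0 : 0 <= K by rewrite sumr_ge0// => a _; rewrite sumr_ge0.
have L0 : 0 <= L by rewrite sumr_ge0.
apply: normed_cvg; apply: (@series_le_cvg _ _ (fun k => L * exp_coeff (K * `|t|) k)).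
- by move=> k; rewrite /=.
- by move=> k; rewrite mulr_ge0// exp_coeff_ge0// mulr_ge0.
- move=> k /=; rewrite /mxexp_coeff /exp_coeff /= normrM normrM normrX normfV normr_nat.
  rewrite (_ : L * _ = L * K ^+ k / k`!%:R * `|t| ^+ k); last by rewrite exprMn; ring.
  rewrite ler_wpM2r ?exprn_ge0// ler_wpM2r//.
  rewrite mxE; apply: (le_trans (ler_norm_sum _ _ _)).
  rewrite mulr_suml; apply: ler_sum => b _; rewrite normrM ler_wpM2l//.
  exact: normr_mxpow_le.
- exact/is_cvg_seriesZ/is_cvg_series_exp_coeff.
Qed.

Lemma mxexp_coeff_diffs M A i j :
  pseries_diffs (mxexp_coeff M A i j) = mxexp_coeff (M *m A) A i j.
Proof.
apply/funext => k; rewrite /pseries_diffs /mxexp_coeff factS natrM.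
have -> : M *m A ^+ k.+1 = M *m A *m A ^+ k by rewrite exprS -mulmxA.
have k1 : k.+1%:R != 0 :> R by rewrite pnatr_eq0.
have kf : k`!%:R != 0 :> R by rewrite pnatr_eq0 -lt0n fact_gt0.
by field; apply/andP; split; rewrite // -?natr1 // addrC natr1.
Qed.

Lemma exprZmx t A k : (t *: A) ^+ k = t ^+ k *: A ^+ k.
Proof.
elim: k => [|k IH]; first by rewrite !expr0 scale1r.
by rewrite !exprS IH -[LHS]/((t *: A) *m _) -scalemxAl -scalemxAr scalerA.
Qed.

Lemma mxexpE A t : mxexp (t *: A) = \matrix_(i, j) limn (pseries (mxexp_coeff 1%:M A i j) t).
Proof.
apply: cvg_lim => //; apply: cvg_mx_entries => i j; rewrite mxE.
rewrite (_ : (fun k => _) = pseries (mxexp_coeff 1%:M A i j) t); first exact: is_cvg_mxexp_coeff.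
apply/funext => k; rewrite /pseries /series /= summxE; apply: eq_bigr => l _.
by rewrite /mxexp_coeff mul1mx exprZmx !mxE; ring.
Qed.

Lemma mulmx_mxexpE M A t i j :
  (M *m mxexp (t *: A)) i j = limn (pseries (mxexp_coeff M A i j) t).
Proof.
rewrite mxE; apply/esym/cvg_lim => //.
rewrite (_ : pseries _ _ = fun k => \sum_l (M i l * pseries (mxexp_coeff 1%:M A l j) t k)).
  apply: cvgn_sum => l; rewrite mxexpE mxE; apply: cvgMr.
  exact: is_cvg_mxexp_coeff.
apply/funext => k; rewrite /pseries /series/=.
under [RHS]eq_bigr do rewrite mulr_sumr.
rewrite exchange_big; apply: eq_bigr => l _ /=.
rewrite /mxexp_coeff mxE mulr_suml mulr_suml; apply: eq_bigr => a _.
by rewrite mul1mx !mulrA.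
Qed.

Lemma is_derive_mxexp A t i j :
  is_derive t 1 (fun r => mxexp (r *: A) i j) ((A *m mxexp (t *: A)) i j).
Proof.
rewrite mulmx_mxexpE -{2}(mul1mx A) -mxexp_coeff_diffs.
under eq_fun do rewrite mxexpE mxE.
apply: (@pseries_snd_diffs _ _ (`|t| + 1)).
- exact: is_cvg_mxexp_coeff.
- by rewrite mxexp_coeff_diffs; exact: is_cvg_mxexp_coeff.
- by rewrite !mxexp_coeff_diffs; exact: is_cvg_mxexp_coeff.
- by rewrite [ltRHS]ger0_norm ?addr_ge0// ltrDl.
Qed.

Lemma mxexp0 A : mxexp (0 *: A) = 1%:M.
Proof.
rewrite mxexpE; apply/matrixP => i j; rewrite mxE.
apply: cvg_lim => //; apply: cvg_near_cst; near=> k.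
have [l ->] : exists l, k = l.+1 by exists k.-1; rewrite prednK//; near: k; exists 1%N.
rewrite /pseries /series/= big_mkord big_ord_recl/= big1 ?addr0.
  by rewrite /mxexp_coeff mul1mx !expr0 fact0 mulr1 divr1.
by move=> a _; rewrite expr0n/= mulr0.
Unshelve. all: by end_near. Qed.

End MatrixExponential.

(** * The Frobenius product and operator norms *)

Section Frobenius.
Context {R : realType}.

Definition frob {p q : nat} (X Y : 'M[R]_(p, q)) : R := \sum_i \sum_j X i j * Y i j.

Section Bilinear.
Context {p q : nat}.
Implicit Types X Y Z : 'M[R]_(p, q).

Lemma frobC X Y : frob X Y = frob Y X.
Proof. by apply: eq_bigr => i _; apply: eq_bigr => j _; rewrite mulrC. Qed.

Lemma frobDl X Y Z : frob (X + Y) Z = frob X Z + frob Y Z.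
Proof.
rewrite /frob -big_split; apply: eq_bigr => i _; rewrite -big_split.
by apply: eq_bigr => j _; rewrite mxE mulrDl.
Qed.

Lemma frobZl (r : R) X Y : frob (r *: X) Y = r * frob X Y.
Proof.
rewrite /frob mulr_sumr; apply: eq_bigr => i _; rewrite mulr_sumr.
by apply: eq_bigr => j _; rewrite mxE mulrA.
Qed.

Lemma frobDr X Y Z : frob X (Y + Z) = frob X Y + frob X Z.
Proof. by rewrite frobC frobDl frobC (frobC Z). Qed.

Lemma frobZr (r : R) X Y : frob X (r *: Y) = r * frob X Y.
Proof. by rewrite frobC frobZl frobC. Qed.

Lemma frobNl X Y : frob (- X) Y = - frob X Y.
Proof. by rewrite -scaleN1r frobZl mulN1r. Qed.

Lemma frobNr X Y : frob X (- Y) = - frob X Y.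
Proof. by rewrite frobC frobNl frobC. Qed.

Lemma frobBl X Y Z : frob (X - Y) Z = frob X Z - frob Y Z.
Proof. by rewrite frobDl frobNl. Qed.

Lemma frobBr X Y Z : frob X (Y - Z) = frob X Y - frob X Z.
Proof. by rewrite frobDr frobNr. Qed.

Lemma frob_ge0 X : 0 <= frob X X.
Proof. by apply: sumr_ge0 => i _; apply: sumr_ge0 => j _; rewrite -expr2 sqr_ge0. Qed.

Lemma frob0r X : frob X 0 = 0.
Proof. by rewrite -(scale0r X) frobZr mul0r. Qed.

Lemma frob_eq0 X : frob X X = 0 -> X = 0.
Proof.
move=> X0; apply/matrixP => i j; rewrite mxE.
have /psumr_eq0P H : \sum_i \sum_j X i j * X i j = 0 by exact: X0.
have /psumr_eq0P H' : \sum_j X i j * X i j = 0.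
  by apply: H => // a _; apply: sumr_ge0 => b _; rewrite -expr2 sqr_ge0.
have /eqP : X i j * X i j = 0 by apply: H' => // b _; rewrite -expr2 sqr_ge0.
by rewrite mulf_eq0 orbb => /eqP.
Qed.

Lemma frob_trace X Y : frob X Y = \tr (X^T *m Y).
Proof.
rewrite /frob exchange_big; apply: eq_bigr => j _.
by rewrite mxE; apply: eq_bigr => i _; rewrite mxE.
Qed.

Lemma frob_cauchy X Y : frob X Y ^+ 2 <= frob X X * frob Y Y.
Proof.
have := frob_ge0 (frob Y Y *: X - frob X Y *: Y).
rewrite !(frobBl, frobBr, frobZl, frobZr) (frobC Y X).
have := frob_ge0 Y; rewrite le_eqVlt => /predU1P[/esym/frob_eq0 -> _|Y0 H].
  by rewrite !frob0r expr0n mulr0.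
rewrite -subr_ge0 -(pmulr_rge0 _ Y0).
by apply: le_trans H _; rewrite le_eqVlt; apply/orP; left; apply/eqP; ring.
Qed.

Lemma frob_young (c : R) X Y : 0 < c -> 2 * frob X Y <= c * frob X X + frob Y Y / c.
Proof.
move=> c0; have := frob_ge0 (c *: X - Y).
rewrite !(frobBl, frobBr, frobZl, frobZr) (frobC Y X) => H.
rewrite -(ler_pM2l c0) mulrDr [X in _ <= _ + X]mulrC divfK ?gt_eqF//.
by lra.
Qed.

Lemma frobD_le X Y : frob (X + Y) (X + Y) <= 2 * frob X X + 2 * frob Y Y.
Proof.
have := frob_ge0 (X - Y); rewrite !(frobBl, frobBr) !(frobDl, frobDr) (frobC Y X); lra.
Qed.

Lemma frobB_le X Y : frob (X - Y) (X - Y) <= 2 * frob X X + 2 * frob Y Y.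
Proof. by have := frobD_le X (- Y); rewrite frobNl frobNr opprK. Qed.

End Bilinear.

Lemma frob_tr {p q} (X Y : 'M[R]_(p, q)) : frob X^T Y^T = frob X Y.
Proof.
rewrite /frob exchange_big; apply: eq_bigr => i _; apply: eq_bigr => j _.
by rewrite !mxE.
Qed.

Lemma frob_mull {p q r} (M : 'M[R]_(p, q)) (X : 'M[R]_(q, r)) Y :
  frob (M *m X) Y = frob X (M^T *m Y).
Proof. by rewrite !frob_trace trmx_mul mulmxA. Qed.

Lemma frob_mulr {p q r} (X : 'M[R]_(p, q)) (M : 'M[R]_(q, r)) Y :
  frob (X *m M) Y = frob X (Y *m M^T).
Proof. by rewrite -frob_tr trmx_mul frob_mull -trmx_mul frob_tr. Qed.

Lemma frob_col {p q} (X : 'M[R]_(p, q)) : frob X X = \sum_j frob (col j X) (col j X).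
Proof.
rewrite /frob exchange_big; apply: eq_bigr => j _.
by apply: eq_bigr => i _; rewrite big_ord1 !mxE.
Qed.

Lemma l2norm_sqr {p} (v : 'cV[R]_p) : l2norm v ^+ 2 = frob v v.
Proof.
rewrite /l2norm sqr_sqrtr; last by rewrite sumr_ge0// => i _; exact: sqr_ge0.
by apply: eq_bigr => i _; rewrite big_ord1 expr2.
Qed.

Lemma l2norm_ge0 {p} (v : 'cV[R]_p) : 0 <= l2norm v.
Proof. exact: sqrtr_ge0. Qed.

Lemma l2normZ {p} (r : R) (v : 'cV[R]_p) : 0 <= r -> l2norm (r *: v) = r * l2norm v.
Proof.
move=> r0; apply/eqP; rewrite -(@eqrXn2 _ 2%N) ?mulr_ge0 ?l2norm_ge0//.
by rewrite exprMn !l2norm_sqr frobZl frobZr mulrA.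
Qed.

Lemma frob_mulmx_le {p q} (M : 'M[R]_(p, q)) (v : 'cV[R]_q) :
  frob (M *m v) (M *m v) <= frob M M * frob v v.
Proof.
rewrite /frob mulr_suml; apply: ler_sum => i _; rewrite big_ord1.
have -> : (M *m v) i 0 = frob (row i M) v^T.
  by rewrite mxE /frob big_ord1; apply: eq_bigr => j _; rewrite !mxE.
rewrite -expr2; apply: (le_trans (frob_cauchy _ _)).
by rewrite frob_tr /frob big_ord1; under eq_bigr do rewrite mxE.
Qed.

Lemma opnorm_ge0 {p q} (M : 'M[R]_(p, q)) : 0 <= opnorm M.
Proof.
have [hs|/sup_out] := pselect (has_sup [set l2norm (M *m v) | v in [set v : 'cV[R]_q | l2norm v <= 1]]).
  have [[y [v v1 yE]] ub] := hs.
  by apply: le_trans (ub_le_sup ub (imageP _ v1)); exact: l2norm_ge0.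
by rewrite /opnorm => ->.
Qed.

(** The operator norm is a supremum, which is only meaningful because the
    Frobenius norm bounds it. *)
Lemma l2norm_mulmx_le {p q} (M : 'M[R]_(p, q)) (v : 'cV[R]_q) :
  l2norm (M *m v) <= opnorm M * l2norm v.
Proof.
have ub : has_ubound [set l2norm (M *m v) | v in [set v : 'cV[R]_q | l2norm v <= 1]].
  exists (Num.sqrt (frob M M)) => _ [u /= u1 <-].
  rewrite -(@ler_pXn2r _ 2%N) ?nnegrE ?sqrtr_ge0 ?l2norm_ge0//.
  rewrite l2norm_sqr sqr_sqrtr ?frob_ge0// (le_trans (frob_mulmx_le _ _))//.
  by rewrite ler_piMr ?frob_ge0// -l2norm_sqr expr_le1// l2norm_ge0.
have := l2norm_ge0 v; rewrite le_eqVlt => /predU1P[v0|v0].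
  have /frob_eq0 -> : frob v v = 0 by rewrite -l2norm_sqr -v0 expr0n.
  rewrite mulmx0 -(scale0r (0 : 'cV[R]_p)) l2normZ// mul0r mulr_ge0 ?l2norm_ge0//.
  exact: opnorm_ge0.
rewrite -ler_pdivrMr// mulrC -l2normZ ?invr_ge0 ?l2norm_ge0//.
rewrite scalemxAr; apply: (ub_le_sup ub); exists ((l2norm v)^-1 *: v) => //=.
by rewrite l2normZ ?invr_ge0 ?l2norm_ge0// mulVf ?gt_eqF.
Qed.

Lemma col_mulmx {p q r} (M : 'M[R]_(p, q)) (X : 'M[R]_(q, r)) j :
  col j (M *m X) = M *m col j X.
Proof. by rewrite !colE mulmxA. Qed.

Lemma col_sub {p q} (X Y : 'M[R]_(p, q)) j : col j (X - Y) = col j X - col j Y.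
Proof. by apply/matrixP => l k; rewrite !mxE. Qed.

Lemma frob_opnorm_col {p q} (M : 'M[R]_(p, q)) (v : 'cV[R]_q) :
  frob (M *m v) (M *m v) <= opnorm M ^+ 2 * frob v v.
Proof.
rewrite -!l2norm_sqr -exprMn ler_pXn2r ?nnegrE ?mulr_ge0 ?l2norm_ge0 ?opnorm_ge0//.
exact: l2norm_mulmx_le.
Qed.

Lemma frob_opnorm {p q r} (M : 'M[R]_(p, q)) (X : 'M[R]_(q, r)) :
  frob (M *m X) (M *m X) <= opnorm M ^+ 2 * frob X X.
Proof.
rewrite !frob_col mulr_sumr; apply: ler_sum => j _.
by rewrite !col_mulmx; exact: frob_opnorm_col.
Qed.

Lemma frob_opnormr {p q r} (X : 'M[R]_(p, q)) (M : 'M[R]_(q, r)) :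
  frob (X *m M) (X *m M) <= opnorm M^T ^+ 2 * frob X X.
Proof. by rewrite -frob_tr trmx_mul (le_trans (frob_opnorm _ _))// frob_tr. Qed.

(** A Kronecker product acts on the stacked columns of X as X |-> S X L^T. *)
Lemma frob_tens {p q} (L : 'M[R]_q) (S : 'M[R]_p) (X : 'M[R]_(p, q)) :
  frob (S *m X *m L^T) (S *m X *m L^T) <= opnorm (L *t S) ^+ 2 * frob X X.
Proof.
pose vec (Y : 'M[R]_(p, q)) : 'cV[R]_(q * p) :=
  \col_a Y (mxtens_unindex a).2 (mxtens_unindex a).1.
have vecE Y : frob (vec Y) (vec Y) = frob Y Y.
  rewrite /frob [RHS]exchange_big pair_big/= [LHS](reindex (@mxtens_index q p))/=.
    by apply: eq_bigr => -[i j] _; rewrite big_ord1 !mxE mxtens_indexK.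
  by exists (@mxtens_unindex q p) => a _; rewrite (mxtens_indexK, mxtens_unindexK).
have vecM : (L *t S) *m vec X = vec (S *m X *m L^T).
  apply/matrixP => a b; rewrite !mxE; case: (mxtens_indexP a) => i k.
  rewrite mxtens_indexK/= [LHS](reindex (@mxtens_index q p))/=; last first.
    by exists (@mxtens_unindex q p) => c _; rewrite (mxtens_indexK, mxtens_unindexK).
  transitivity (\sum_j \sum_l L i j * S k l * X l j).
    rewrite pair_big/=; apply: eq_bigr => -[j l] _.
    by rewrite tensmxE mxE mxtens_indexK.
  apply: eq_bigr => j _; rewrite !mxE mulr_suml; apply: eq_bigr => l _.
  by ring.
by rewrite -(vecE (S *m X *m L^T)) -vecM -(vecE X); exact: frob_opnorm_col.
Qed.

End Frobenius.

(** * The Laplacian of the gauged graph *)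

Section GaugedLaplacian.
Context {R : realType} {N : nat}.
Variables (W : 'M[R]_N) (sigma : 'I_N -> R).
Hypothesis Wsym : W^T = W.
Hypothesis Wconn : graph_connected W.
Hypothesis sigma1 : forall i, sigma i = 1 \/ sigma i = -1.
Hypothesis Wgauge : forall i j, 0 <= (gauge_mx sigma *m W *m gauge_mx sigma) i j.

Local Notation LD := (gauged_laplacian W sigma).

Lemma gauge_sqr i : sigma i * sigma i = 1.
Proof. by case: (sigma1 i) => ->; rewrite ?mulrNN mulr1. Qed.

Lemma gauge_mxK : gauge_mx sigma *m gauge_mx sigma = 1%:M.
Proof.
rewrite /gauge_mx mulmx_diag; apply/matrixP => i j; rewrite !mxE.
by rewrite gauge_sqr.
Qed.

Lemma gauge_mulE (M : 'M[R]_N) i j :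
  (gauge_mx sigma *m M *m gauge_mx sigma) i j = sigma i * M i j * sigma j.
Proof. by rewrite /gauge_mx mul_mx_diag mxE mul_diag_mx !mxE. Qed.

(** Gauging turns the signed weights into their absolute values, so that LD is
    the Laplacian of an unsigned graph. *)
Lemma gauge_weight i j : sigma i * W i j * sigma j = `|W i j|.
Proof.
rewrite -[LHS]ger0_norm; last by rewrite -gauge_mulE.
have s1 k : `|sigma k| = 1 by case: (sigma1 k) => ->; rewrite ?normrN normr1.
by rewrite !normrM !s1 mulr1 mul1r.
Qed.

Lemma gauged_laplacianE i j : LD i j = (i == j)%:R * (\sum_k `|W i k|) - `|W i j|.
Proof.
rewrite /gauged_laplacian gauge_mulE /laplacian !mxE -gauge_weight mulrBr mulrBl.
congr (_ - _); case: eqP => [->|_]; last by rewrite mulr0n mulr0 mul0r mul0r.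
by rewrite mulr1n mulrAC gauge_sqr.
Qed.

Lemma absW_sym i j : `|W i j| = `|W j i|.
Proof. by rewrite -{1}Wsym mxE. Qed.

Lemma gauged_laplacian_sym : LD^T = LD.
Proof.
apply/matrixP => i j; rewrite mxE !gauged_laplacianE absW_sym eq_sym.
by case: eqP => [->//|_]; rewrite !mul0r.
Qed.

Lemma gauged_laplacian_sum0 j : \sum_i LD i j = 0.
Proof.
under eq_bigr do rewrite gauged_laplacianE.
rewrite sumrB (bigD1 j)//= eqxx mul1r [X in _ + X - _]big1; last first.
  by move=> i /negbTE ->; rewrite mul0r.
by rewrite addr0; apply/eqP; rewrite subr_eq0; apply/eqP/eq_bigr => i _; exact: absW_sym.
Qed.

Lemma mulmx_gauged_laplacianE p (X : 'M[R]_(p, N)) l i :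
  (X *m LD) l i = \sum_j `|W i j| * (X l i - X l j).
Proof.
rewrite mxE; under [RHS]eq_bigr do rewrite mulrBr.
rewrite sumrB -mulr_suml.
under eq_bigr do rewrite gauged_laplacianE mulrBr.
rewrite sumrB (bigD1 i)//= eqxx mul1r [X in _ + X - _]big1; last first.
  by move=> j /negbTE ->; rewrite mul0r mulr0.
rewrite addr0 mulrC; congr (_ - _); apply: eq_bigr => j _.
by rewrite mulrC absW_sym.
Qed.

Lemma gauged_laplacian_form p (X : 'M[R]_(p, N)) :
  2 * frob X (X *m LD) = \sum_l \sum_i \sum_j `|W i j| * (X l i - X l j) ^+ 2.
Proof.
rewrite /frob mulr_sumr; apply: eq_bigr => l _.
under eq_bigr do rewrite mulmx_gauged_laplacianE mulr_sumr.
rewrite mulr_natl mulr2n {2}exchange_big -big_split; apply: eq_bigr => i _.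
rewrite -big_split; apply: eq_bigr => j _ /=.
by rewrite (absW_sym j i); ring.
Qed.

Lemma gauged_laplacian_psd p (X : 'M[R]_(p, N)) : 0 <= frob X (X *m LD).
Proof.
rewrite -(pmulr_rge0 _ (ltr0Sn R 1)) gauged_laplacian_form.
by do 3 (apply: sumr_ge0 => ? _); rewrite mulr_ge0// sqr_ge0.
Qed.

(** Connectivity makes the kernel of the Laplacian one-dimensional. *)
Lemma gauged_laplacian_ker (y : 'rV[R]_N) : frob y (y *m LD) = 0 -> forall i j, y 0 i = y 0 j.
Proof.
move=> y0.
have E i j : W i j != 0 -> y 0 i = y 0 j.
  move=> Wij; have := gauged_laplacian_form y; rewrite y0 mulr0 big_ord1.
  move=> /esym/psumr_eq0P H.
  have /psumr_eq0P H' : \sum_j `|W i j| * (y 0 i - y 0 j) ^+ 2 = 0.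
    by apply: H => // a _; apply: sumr_ge0 => b _; rewrite mulr_ge0// sqr_ge0.
  have /eqP : `|W i j| * (y 0 i - y 0 j) ^+ 2 = 0.
    by apply: H' => // b _; rewrite mulr_ge0// sqr_ge0.
  by rewrite mulf_eq0 normr_eq0 (negbTE Wij)/= sqrf_eq0 subr_eq0 => /eqP.
move=> i j; have /connectP[r] := Wconn i j.
elim: r i => [|k r IH] i /=; first by move=> _ ->.
by move=> /andP[Wik rP] jE; rewrite (E i k)//; exact: IH.
Qed.

(** The gauge is an involution that conjugates the two Laplacians. *)
Lemma gauged_laplacian_eigenvalue mu : eigenvalue LD mu -> eigenvalue (laplacian W) mu.
Proof.
move=> /eigenvalueP[v vL v0]; apply/eigenvalueP; exists (v *m gauge_mx sigma).
  by rewrite scalemxAl -vL /gauged_laplacian -!mulmxA gauge_mxK mulmx1.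
apply/eqP => H; have := congr1 (mulmx^~ (gauge_mx sigma)) H.
by rewrite -mulmxA gauge_mxK mulmx1 mul0mx => /eqP; rewrite (negbTE v0).
Qed.

Lemma continuous_sum (I : finType) (T : topologicalType) (f : I -> T -> R) :
  (forall i, continuous (f i)) -> continuous (fun t => \sum_i f i t).
Proof.
move=> cf; suff H r : continuous (fun t => \sum_(i <- r) f i t) by exact: H.
elim: r => [|i r IH] t.
  by under eq_fun do rewrite big_nil; exact: cst_continuous.
by under eq_fun do rewrite big_cons; apply: continuousD; [exact: cf|exact: IH].
Qed.

Lemma continuous_frob_mul (M : 'M[R]_N) : continuous (fun y : 'rV[R]_N => frob y (y *m M)).
Proof.
apply: continuous_sum => i; apply: continuous_sum => j y; apply: continuousM.
  exact: coord_continuous.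
rewrite (_ : (fun z : 'rV[R]_N => _) = (fun z => \sum_k z i k * M k j)); last first.
  by apply/funext => z; rewrite mxE.
move: y; apply: continuous_sum => k y; apply: continuousM; first exact: coord_continuous.
exact: cst_continuous.
Qed.

(** Since the sphere of zero-sum unit vectors is compact, the Rayleigh
    quotient has a minimiser there; it is an eigenvector, and its eigenvalue
    is positive because the kernel only contains constant vectors. *)
Lemma rayleigh_eigenvalue (v : 'rV[R]_N) : \sum_j v 0 j = 0 -> frob v v = 1 ->
  exists mu, [/\ 0 < mu, eigenvalue LD mu &
    forall y : 'rV[R]_N, \sum_j y 0 j = 0 -> mu * frob y y <= frob y (y *m LD)].
Proof.
move=> v_sum v1.
pose S := [set y : 'rV[R]_N | \sum_j y 0 j = 0 /\ frob y y = 1].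
have cS : compact S.
  apply: bounded_closed_compact.
    exists 1; split; first exact: num_real.
    move=> M M1 y [_ y1] /=.
    rewrite /Num.Def.normr/= mx_normrE (bigmax_le _ (ltW (lt_trans ltr01 M1)))//= => -[i j] _ /=.
    apply: le_trans (ltW M1); rewrite -(@ler_pXn2r _ 2%N) ?nnegrE// expr1n -y1 /frob.
    rewrite (bigD1 i)//= (bigD1 j)//= -normrX ger0_norm ?sqr_ge0// expr2 -addrA lerDl.
    rewrite addr_ge0//; last by apply: sumr_ge0 => a _; apply: sumr_ge0 => b _; rewrite -expr2 sqr_ge0.
    by apply: sumr_ge0 => a _; rewrite -expr2 sqr_ge0.
  have -> : S = (fun y : 'rV[R]_N => \sum_j y 0 j) @^-1` [set 0] `&`
      (fun y => frob y (y *m 1%:M)) @^-1` [set 1].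
    by apply/seteqP; split => y /=; rewrite /S /= mulmx1.
  apply: closedI; apply: closed_comp; try exact: closed_eq.
  - by move=> y _; apply: continuous_sum => j z; exact: coord_continuous.
  - by move=> y _; exact: continuous_frob_mul.
have S0 : S !=set0 by exists v.
have cf : {within S, continuous (fun y : 'rV[R]_N => frob y (y *m LD))}.
  exact/continuous_subspaceT/continuous_frob_mul.
have [u uS umin] := EVT_min_rV S0 cS cf.
have [u_sum u1] : S u by rewrite inE in uS.
set mu := frob u (u *m LD).
have quad (y : 'rV[R]_N) : \sum_j y 0 j = 0 -> mu * frob y y <= frob y (y *m LD).
  move=> y_sum; have := frob_ge0 y; rewrite le_eqVlt => /predU1P[/esym y0|y0].
    by rewrite y0 mulr0 gauged_laplacian_psd.
  pose r := Num.sqrt (frob y y).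
  have r0 : 0 < r by rewrite sqrtr_gt0.
  have rr : r * r = frob y y by rewrite -expr2 sqr_sqrtr// ltW.
  have : r^-1 *: y \in S.
    rewrite inE; split.
      by under eq_bigr do rewrite mxE; rewrite -mulr_sumr y_sum mulr0.
    by rewrite frobZl frobZr -rr; field; rewrite gt_eqF.
  move=> /umin; rewrite -/mu -scalemxAl frobZl frobZr -rr => H.
  have -> : frob y (y *m LD) = r^-1 * (r^-1 * frob y (y *m LD)) * (r * r).
    by field; rewrite gt_eqF.
  by rewrite ler_wpM2r// mulr_ge0// ltW.
have [w wE] : exists w : 'rV[R]_N, w = u *m LD - mu *: u by eexists.
have w_sum : \sum_j w 0 j = 0.
  rewrite (eq_bigr (fun j => \sum_k u 0 k * LD k j - mu * u 0 j)); last first.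
    by move=> j _; rewrite wE !mxE.
  rewrite sumrB -mulr_sumr u_sum mulr0 subr0 exchange_big big1//= => k _.
  rewrite -mulr_sumr.
  have -> : \sum_j LD k j = \sum_j LD j k.
    by apply: eq_bigr => j _; rewrite -{1}gauged_laplacian_sym mxE.
  by rewrite gauged_laplacian_sum0 mulr0.
have w0 : w = 0.
  apply: frob_eq0.
  (* Perturbing the minimiser u by s w gives a polynomial in s that is
     nonnegative and vanishes at 0, so its linear coefficient 2 a is zero. *)
  pose a := frob w w; pose d := frob w (w *m LD) - mu * frob w w.
  have d0 : 0 <= d by rewrite subr_ge0 quad.
  have H (s : R) : 0 <= 2 * s * a + s ^+ 2 * d.
    have sum0 : \sum_j (u + s *: w) 0 j = 0.
      under eq_bigr do rewrite mxE [X in _ + X]mxE.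
      by rewrite big_split/= u_sum -mulr_sumr w_sum mulr0 addr0.
    have := quad _ sum0.
    rewrite mulmxDl -scalemxAl !(frobDl, frobDr, frobZl, frobZr).
    have -> : frob u (w *m LD) = frob w (u *m LD).
      by rewrite frobC frob_mulr gauged_laplacian_sym.
    rewrite -/mu u1 (frobC u w).
    have aE : a = frob w (u *m LD) - mu * frob w u by rewrite /a [X in frob _ X]wE frobBr frobZr.
    have -> : frob w (u *m LD) = a + mu * frob w u by rewrite aE subrK.
    have -> : frob w (w *m LD) = d + mu * frob w w by rewrite /d subrK.
    by nra.
  have a0 : 0 <= a := frob_ge0 w.
  have d1 : 0 < d + 1 by lra.
  have := H (- a / (d + 1)).
  have -> : 2 * (- a / (d + 1)) * a + (- a / (d + 1)) ^+ 2 * d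
      = - (a ^+ 2 * (d + 2) / (d + 1) ^+ 2) by field; rewrite gt_eqF.
  rewrite oppr_ge0 => H'.
  have : a ^+ 2 * (d + 2) / (d + 1) ^+ 2 = 0.
    by apply/eqP; rewrite eq_le H'/= divr_ge0 ?mulr_ge0 ?sqr_ge0// addr_ge0.
  move=> /eqP; rewrite !mulf_eq0 invr_eq0 !sqrf_eq0 (gt_eqF d1) orbF.
  by rewrite [d + 2 == 0]gt_eqF ?orbF ?orbb ?ltr_wpDl// => /eqP.
have uL : u *m LD = mu *: u by apply/eqP; rewrite -subr_eq0 -wE w0.
have u0 : u != 0.
  by apply/eqP => u0; move: u1; rewrite u0 frob0r => /eqP; rewrite eq_sym oner_eq0.
exists mu; split => //; last by apply/eigenvalueP; exists u.
rewrite lt_neqAle gauged_laplacian_psd andbT eq_sym; apply/eqP => mu0.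
have uconst := gauged_laplacian_ker mu0.
case/eqP: u0; apply/matrixP => i j; rewrite ord1 mxE.
have : \sum_k u 0 k = N%:R * u 0 j.
  by rewrite (eq_bigr (fun=> u 0 j)) ?sumr_const ?card_ord ?mulr_natl.
rewrite u_sum => /esym/eqP; rewrite mulf_eq0 pnatr_eq0 => /orP[/eqP N0|/eqP //].
by exfalso; have := leq_ltn_trans (leq0n j) (ltn_ord j); rewrite N0.
Qed.

(** The smallest positive eigenvalue is at most the minimum of the Rayleigh
    quotient, which is itself a positive eigenvalue. *)
Lemma spectral_gap (alpha : R) p (X : 'M[R]_(p, N)) :
  smallest_pos_eigenvalue (laplacian W) alpha -> (forall l, \sum_j X l j = 0) ->
  alpha * frob X X <= frob X (X *m LD).
Proof.
move=> [alpha0 _ alpha_min] X_sum.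
have -> : frob X X = \sum_l frob (row l X) (row l X).
  by apply: eq_bigr => l _; rewrite /frob big_ord1; apply: eq_bigr => j _; rewrite !mxE.
have -> : frob X (X *m LD) = \sum_l frob (row l X) (row l X *m LD).
  apply: eq_bigr => l _; rewrite /frob big_ord1; apply: eq_bigr => j _.
  by rewrite -row_mul !mxE.
rewrite mulr_sumr; apply: ler_sum => l _; set y := row l X.
have y_sum : \sum_j y 0 j = 0 by under eq_bigr do rewrite mxE; exact: X_sum.
have := frob_ge0 y; rewrite le_eqVlt => /predU1P[/esym y0|y0].
  by rewrite y0 mulr0 gauged_laplacian_psd.
pose r := Num.sqrt (frob y y).
have r0 : 0 < r by rewrite sqrtr_gt0.
have rr : r * r = frob y y by rewrite -expr2 sqr_sqrtr// ltW.
have v_sum : \sum_j (r^-1 *: y) 0 j = 0.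
  by under eq_bigr do rewrite mxE; rewrite -mulr_sumr y_sum mulr0.
have v1 : frob (r^-1 *: y) (r^-1 *: y) = 1.
  by rewrite frobZl frobZr -rr; field; rewrite gt_eqF.
have [mu [mu0 /gauged_laplacian_eigenvalue muE quad]] := rayleigh_eigenvalue v_sum v1.
by apply: le_trans (quad y y_sum); rewrite ler_wpM2r ?frob_ge0 ?alpha_min.
Qed.

End GaugedLaplacian.

(** * Piecewise smooth matrix functions *)

Section PiecewiseSmoothMatrices.
Context {R : realType}.
Implicit Types (s : seq R) (a b t : R).

Definition mx_derive s a b {p q : nat} (X X' : R -> 'M[R]_(p, q)) : Prop :=
  forall i j, pw_derive s a b (fun t => X t i j) (fun t => X' t i j).

Definition mx_continuous s a b {p q : nat} (X : R -> 'M[R]_(p, q)) : Prop :=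
  forall i j, pw_continuous s a b (fun t => X t i j).

Lemma is_derive_pw_derive s a b (f df : R -> R) :
  (forall t, is_derive t 1 f (df t)) -> pw_derive s a b f df.
Proof.
move=> fP; split => [|t _ _]; last exact: fP.
apply: continuous_subspaceT => t; apply/differentiable_continuous/derivable1_diffP.
by have [] := fP t.
Qed.

Lemma is_derive_entry {p q} (X : R -> 'M[R]_(p, q)) X' t i j :
  is_derive t 1 X X' -> is_derive t 1 (fun r => X r i j) (X' i j).
Proof.
move=> [dX <-]; rewrite derive_mx// mxE.
by have /derivable_mxP/(_ i j) dXij := dX; exact: derivableP.
Qed.

Lemma within_entry {p q} (S : set R) (X : R -> 'M[R]_(p, q)) i j :
  {within S, continuous X} -> {within S, continuous (fun t => X t i j)}.
Proof.
move=> cX x; apply: (@continuous_comp (subspace S) _ _ X (fun M : 'M[R]_(p, q) => M i j) x).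
  exact: cX.
exact: coord_continuous.
Qed.

Section Algebra.
Context {s : seq R} {a b : R}.

Lemma eq_mx_derive {p q} (X Y X' Y' : R -> 'M[R]_(p, q)) : (forall t, X t = Y t) ->
  (forall t, a < t < b -> t \notin s -> X' t = Y' t) ->
  mx_derive s a b X X' -> mx_derive s a b Y Y'.
Proof.
move=> XY XY' dX i j; apply: eq_pw_derive (dX i j) => [t|t tab ts]; first by rewrite XY.
by rewrite XY'.
Qed.

Lemma mx_deriveB {p q} (X X' Y Y' : R -> 'M[R]_(p, q)) :
  mx_derive s a b X X' -> mx_derive s a b Y Y' ->
  mx_derive s a b (fun t => X t - Y t) (fun t => X' t - Y' t).
Proof.
move=> dX dY i j; apply: eq_pw_derive (pw_deriveB (dX i j) (dY i j)).
  by move=> t; rewrite !mxE.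
by move=> t _ _; rewrite !mxE.
Qed.

Lemma mx_derive_mull {p q r} (M : 'M[R]_(r, p)) (X X' : R -> 'M[R]_(p, q)) :
  mx_derive s a b X X' -> mx_derive s a b (fun t => M *m X t) (fun t => M *m X' t).
Proof.
move=> dX i j; apply: eq_pw_derive
  (pw_derive_sum (fun k => pw_deriveZ (M i k) (dX k j))) => [t|t _ _]; by rewrite mxE.
Qed.

Lemma mx_derive_tr {p q} (X X' : R -> 'M[R]_(p, q)) :
  mx_derive s a b X X' -> mx_derive s a b (fun t => (X t)^T) (fun t => (X' t)^T).
Proof.
by move=> dX i j; apply: eq_pw_derive (dX j i) => [t|t _ _]; rewrite mxE.
Qed.

Lemma mx_derive_mulr {p q r} (X X' : R -> 'M[R]_(p, q)) (M : 'M[R]_(q, r)) :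
  mx_derive s a b X X' -> mx_derive s a b (fun t => X t *m M) (fun t => X' t *m M).
Proof.
move=> /mx_derive_tr/(mx_derive_mull M^T)/mx_derive_tr.
by apply: eq_mx_derive => [t|t _ _]; rewrite -trmx_mul trmxK.
Qed.

Lemma mx_derive_col {p q} (X X' : R -> 'M[R]_(p, q)) j :
  mx_derive s a b X X' -> mx_derive s a b (fun t => col j (X t)) (fun t => col j (X' t)).
Proof. by move=> dX i k; apply: eq_pw_derive (dX i j) => [t|t _ _]; rewrite mxE. Qed.

Lemma pw_derive_frob {p q} (X X' Y Y' : R -> 'M[R]_(p, q)) :
  mx_derive s a b X X' -> mx_derive s a b Y Y' ->
  pw_derive s a b (fun t => frob (X t) (Y t)) (fun t => frob (X' t) (Y t) + frob (X t) (Y' t)).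
Proof.
move=> dX dY.
apply: eq_pw_derive (pw_derive_sum (fun i => pw_derive_sum (fun j =>
  pw_deriveM (dX i j) (dY i j)))) => [t|t _ _] //.
by rewrite /frob -big_split; apply: eq_bigr => i _; rewrite -big_split.
Qed.

Lemma mx_derive_continuous {p q} (X X' : R -> 'M[R]_(p, q)) :
  mx_derive s a b X X' -> mx_continuous s a b X.
Proof. by move=> dX i j; apply: within_pw_continuous; have [] := dX i j. Qed.

Lemma mx_continuousB {p q} (X Y : R -> 'M[R]_(p, q)) :
  mx_continuous s a b X -> mx_continuous s a b Y ->
  mx_continuous s a b (fun t => X t - Y t).
Proof.
move=> cX cY i j; under eq_fun do rewrite mxE [X in _ + X]mxE.
exact: pw_continuousB (cX i j) (cY i j).
Qed.

Lemma mx_continuous_mulr {p q r} (X : R -> 'M[R]_(p, q)) (M : 'M[R]_(q, r)) :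
  mx_continuous s a b X -> mx_continuous s a b (fun t => X t *m M).
Proof.
move=> cX i j; under eq_fun do rewrite mxE; apply: pw_continuous_sum => k.
by apply: pw_continuousM => //; exact: pw_continuous_cst.
Qed.

Lemma mx_continuous_col {p q} (X : R -> 'M[R]_(p, q)) j :
  mx_continuous s a b X -> mx_continuous s a b (fun t => col j (X t)).
Proof. by move=> cX i k; under eq_fun do rewrite mxE. Qed.

Lemma pw_continuous_frob {p q} (X Y : R -> 'M[R]_(p, q)) :
  mx_continuous s a b X -> mx_continuous s a b Y ->
  pw_continuous s a b (fun t => frob (X t) (Y t)).
Proof.
by move=> cX cY; do 2 (apply: pw_continuous_sum => ?); exact: pw_continuousM.
Qed.

End Algebra.

Lemma mx_deriveW s a b c d {p q} (X X' : R -> 'M[R]_(p, q)) : a <= c -> d <= b ->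
  mx_derive s a b X X' -> mx_derive s c d X X'.
Proof. by move=> ac db dX i j; exact: pw_deriveW (dX i j). Qed.

Lemma mx_continuousW s a b c d {p q} (X : R -> 'M[R]_(p, q)) : a <= c -> d <= b ->
  mx_continuous s a b X -> mx_continuous s c d X.
Proof. by move=> ac db cX i j; exact: pw_continuousW (cX i j). Qed.

Lemma mx_derive_flow s a b {n q} (A : 'M[R]_n) (v : 'M[R]_(n, q)) c :
  mx_derive s a b (fun t => mxexp ((t - c) *: A) *m v)
    (fun t => A *m (mxexp ((t - c) *: A) *m v)).
Proof.
have dE : mx_derive s a b (fun t => mxexp ((t - c) *: A)) (fun t => A *m mxexp ((t - c) *: A)).
  move=> i k; apply: is_derive_pw_derive => t.
  have H := is_derive_mxexp A (t - c) i k.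
  have H' : is_derive t 1 (fun r : R => r - c) 1 by exact: is_derive_shift.
  by have := @is_derive1_comp R _ _ t _ _ H H'; rewrite mulr1.
by apply: eq_mx_derive (mx_derive_mulr v dE) => [//|t _ _]; rewrite mulmxA.
Qed.

Lemma frob_mxexp_bounded {n} (A : 'M[R]_n) b :
  exists M, forall t, 0 <= t <= b -> frob (mxexp (t *: A)) (mxexp (t *: A)) <= M.
Proof.
have dE := mx_derive_flow [::] 0 b A 1%:M 0.
have [c _] := pw_derive_frob dE dE.
have [M HM] := within_continuous_bounded c.
exists M => t tb; apply: le_trans (HM t tb).
by rewrite mulmx1 subr0 ler_norm.
Qed.

End PiecewiseSmoothMatrices.

(** * Triggering instants and sampled signals *)

Section Instants.
Context {R : realType}.

Definition well_timed (U : nat -> \bar R) : Prop :=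
  U 0%N = 0%E /\ forall k, (U k <= U k.+1)%E.

Section OneAgent.
Variable U : nat -> \bar R.
Hypothesis Uwt : well_timed U.

Lemma instant_le k l : (k <= l)%N -> (U k <= U l)%E.
Proof. by have [_ Umono] := Uwt; move=> kl; apply: (homo_leq le_refl le_trans) kl. Qed.

Lemma instant_ge0 k : (0 <= U k)%E.
Proof. by have [<- _] := Uwt; exact: instant_le. Qed.

Lemma instant_fin k (t : R) : (U k <= t%:E)%E -> U k = (fine (U k))%:E.
Proof.
move=> Ut; rewrite fineK// fin_numElt (lt_le_trans _ (instant_ge0 k)) ?ltNy0//.
by rewrite (le_lt_trans Ut) ?ltry.
Qed.

Lemma last_instantE k (t : R) : (U k <= t%:E)%E -> (t%:E < U k.+1)%E ->
  last_instant U t = fine (U k).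
Proof.
move=> Ukt tUk; rewrite /last_instant; congr fine; apply/le_anti/andP; split.
  apply: ge_ereal_sup => _ [l /= Ult <-]; apply: instant_le.
  rewrite leqNgt; apply/negP => /instant_le/(lt_le_trans tUk)/lt_le_trans/(_ Ult).
  by rewrite ltxx.
by apply: ereal_sup_ubound; exists k.
Qed.

Lemma instant_index (t : R) : 0 <= t -> (t%:E < ereal_sup (range U))%E ->
  exists k, (U k <= t%:E)%E /\ (t%:E < U k.+1)%E.
Proof.
move=> t0 /ereal_sup_gt[_ [l _ <-] tl].
have ex : exists l, (t%:E < U l)%E by exists l.
case: (ex_minnP ex) => -[|k] tk kmin.
  by move: tk; have [-> _] := Uwt; rewrite lte_fin ltNge t0.
exists k; split => //; rewrite leNgt; apply/negP => /kmin.
by rewrite ltnn.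
Qed.

Lemma last_instant_itv (t : R) : 0 <= t -> (t%:E < ereal_sup (range U))%E ->
  0 <= last_instant U t <= t.
Proof.
move=> t0 /(instant_index t0)[k [Ukt tUk]]; rewrite (last_instantE Ukt tUk).
have := instant_ge0 k; have := Ukt.
by rewrite (instant_fin Ukt) !lee_fin => -> ->.
Qed.

(** Away from the instants, a sampled signal is locally a single flow line of
    A, which is how its derivative is computed. *)
Lemma last_instant_near (t : R) : 0 <= t -> (t%:E < ereal_sup (range U))%E ->
  (forall k, U k != t%:E) -> \forall r \near t, last_instant U r = last_instant U t.
Proof.
move=> t0 tU Ut; have [k [Ukt tUk]] := instant_index t0 tU.
rewrite (last_instantE Ukt tUk).
have kE := instant_fin Ukt.
have kt : fine (U k) < t by rewrite -lte_fin -kE lt_neqAle Ut Ukt.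
have : \forall r \near t, (r%:E < U k.+1)%E.
  move: tUk; case: (U k.+1) => [u||] //=; rewrite ?lte_fin => tu.
    by near=> r; rewrite lte_fin; near: r; exact: lt_nbhsl.
  by near=> r; rewrite ltry.
move=> tnear; near=> r; apply: last_instantE; last by near: r.
by rewrite kE lee_fin; apply: ltW; near: r; exact: lt_nbhsr.
Unshelve. all: by end_near. Qed.

Lemma instants_finite (b : R) : (b%:E < ereal_sup (range U))%E ->
  exists s : seq R, forall t, t <= b -> t \notin s -> forall k, U k != t%:E.
Proof.
move=> /ereal_sup_gt[_ [l _ <-] bl].
exists [seq fine (U k) | k <- iota 0 l] => t tb ts k; apply/eqP => kt.
have kl : (k < l)%N.
  rewrite ltnNge; apply/negP => /instant_le; rewrite leNgt kt => /negP; apply.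
  by apply: le_lt_trans bl; rewrite lee_fin.
by move/negP: ts; apply; apply/mapP; exists k; rewrite ?mem_iota// kt.
Qed.

End OneAgent.

Lemma lt_lifetime {N} (T : instants R N) (t : R) : (t%:E < lifetime T)%E ->
  forall i, (t%:E < ereal_sup (range (T i)))%E.
Proof. by move=> tT i; apply: (lt_le_trans tT); apply: ereal_inf_lbound; exists i. Qed.

Lemma all_instants_finite {N} (T : instants R N) (b : R) :
  (forall i, well_timed (T i)) -> (b%:E < lifetime T)%E ->
  exists s : seq R, forall t, t <= b -> t \notin s -> forall i k, T i k != t%:E.
Proof.
move=> Twt bT.
have H i := instants_finite (Twt i) (lt_lifetime bT i).
exists (flatten [seq sval (cid (H i)) | i <- enum 'I_N]) => t tb ts i k.
apply: (svalP (cid (H i)) t tb); apply: contra ts => ti.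
apply/flattenP; exists (sval (cid (H i))) => //.
by apply: map_f; rewrite mem_enum.
Qed.

Lemma stop_after_well_timed {N} (T : instants R N) i k :
  (forall j, well_timed (T j)) -> forall j, well_timed (stop_after T i k j).
Proof.
move=> Twt j; have [T0 Tmono] := Twt j.
rewrite /stop_after; split => [|l] /=; first by rewrite ltn0 andbF.
case: ifP => [/andP[-> kl]|_] /=; first by rewrite (ltnW kl : (k < l.+1)%N).
by case: ifP => // _; rewrite leey.
Qed.

End Instants.

Section SampledSignal.
Context {R : realType} {N n : nat}.
Variables (A : 'M[R]_n) (T : instants R N) (x : signal R N n).
Hypothesis Twt : forall i, well_timed (T i).

Lemma xhat_derive i (t : R) l : 0 < t -> (t%:E < lifetime T)%E ->
  (forall k, T i k != t%:E) ->
  is_derive t 1 (fun r => xhat A T x i r l 0) ((A *m xhat A T x i t) l 0).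
Proof.
move=> t0 /lt_lifetime/(_ i) tT Tt.
rewrite [in X in is_derive _ _ _ X]/xhat /=.
set c := last_instant (T i) t.
apply: (@near_eq_is_derive _ _ _ (fun r => (mxexp ((r - c) *: A) *m x i c) l 0)).
  have := last_instant_near (Twt i) (ltW t0) tT Tt.
  by apply: filterS => r rE; rewrite /xhat rE.
have [_ H] := mx_derive_flow [::] (t - 1) (t + 1) A (x i c) c l 0.
by apply: H => //; lra.
Qed.

(** The sampled state is x at some earlier time, transported by e^(tA) with t at
    most b; this bounds it by the maximum of x on [0, b]. *)
Lemma xhat_continuous s b : 0 <= b -> (b%:E < lifetime T)%E ->
  (forall i, {within `[0, b], continuous (x i)}) ->
  (forall t, t <= b -> t \notin s -> forall i k, T i k != t%:E) ->
  forall i, mx_continuous s 0 b (xhat A T x i).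
Proof.
move=> b0 bT cx sT i l j; rewrite ord1 {j}; split.
  move=> t /andP[t0 tb] ts; apply/differentiable_continuous/derivable1_diffP.
  have tT : (t%:E < lifetime T)%E by apply: le_lt_trans bT; rewrite lee_fin ltW.
  by have [] := xhat_derive l t0 tT (sT t (ltW tb) ts i).
have [M HM] := frob_mxexp_bounded A b.
have [M' HM'] : exists M', forall t, 0 <= t <= b -> frob (x i t) (x i t) <= M'.
  have : pw_continuous [::] 0 b (fun t => frob (x i t) (x i t)).
    apply: pw_continuous_frob => k j; apply: within_pw_continuous; exact: within_entry.
  by move=> [_ [M' H]]; exists M' => t tb; exact: le_trans (ler_norm _) (H t tb).
exists (Num.sqrt (M * M')) => t /andP[t0 tb].
have tT : (t%:E < lifetime T)%E by apply: le_lt_trans bT; rewrite lee_fin.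
have /andP[c0 ct] := last_instant_itv (Twt i) t0 (lt_lifetime tT i).
have le1 : frob (xhat A T x i t) (xhat A T x i t) <= M * M'.
  apply: (le_trans (frob_mulmx_le _ _)); apply: ler_pM; rewrite ?frob_ge0//.
    by apply: HM; rewrite subr_ge0 ct lerBlDr (le_trans tb)// lerDl.
  by apply: HM'; rewrite c0 (le_trans ct).
rewrite -sqrtr_sqr ler_wsqrtr//; apply: le_trans le1.
rewrite /frob (bigD1 l)//= big_ord1 expr2 lerDl sumr_ge0// => k _.
by rewrite big_ord1 -expr2 sqr_ge0.
Qed.

End SampledSignal.

(** * The gauged closed loop *)

Section ClosedLoop.
Context {R : realType} {N n m : nat}.
Variables (A : 'M[R]_n) (B : 'M[R]_(n, m)) (K : 'M[R]_(m, n)) (W : 'M[R]_N).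
Variables (sigma beta : 'I_N -> R) (h : R -> R).
Hypothesis Wsym : W^T = W.
Hypothesis sigma1 : forall i, sigma i = 1 \/ sigma i = -1.
Hypothesis Wgauge : forall i j, 0 <= (gauge_mx sigma *m W *m gauge_mx sigma) i j.

Local Notation LD := (gauged_laplacian W sigma).

Definition gauged (x : signal R N n) (t : R) : 'M[R]_(n, N) :=
  \matrix_(l, i) (sigma i * x i t l 0).

Lemma col_gauged x t i : col i (gauged x t) = sigma i *: x i t.
Proof. by apply/matrixP => l j; rewrite !mxE ord1. Qed.

Lemma col_gauged_laplacian (Z : 'M[R]_(n, N)) i :
  col i (Z *m LD) = \sum_j `|W i j| *: (col i Z - col j Z).
Proof.
apply/matrixP => l j; rewrite mxE mulmx_gauged_laplacianE// summxE.
by apply: eq_bigr => k _; rewrite !mxE.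
Qed.

Lemma gauge_weight_sg i j : sigma i * (`|W i j| * Num.sg (W i j)) = `|W i j| * sigma j.
Proof.
rewrite mulrC -[X in X * _]mulrC -numEsg.
rewrite -(gauge_weight sigma1 Wgauge) -[RHS]mulrA (gauge_sqr sigma1) mulr1.
by rewrite mulrC.
Qed.

Lemma gauge_control T x i t :
  sigma i *: control A K W T x i t = - (K *m col i (gauged (xhat A T x) t *m LD)).
Proof.
rewrite /control scalerN scalemxAr; congr (- (K *m _)).
rewrite col_gauged_laplacian scaler_sumr; apply: eq_bigr => j _.
rewrite !col_gauged !scalerBr !scalerA [sigma i * `|_|]mulrC; congr (_ - _).
by rewrite -mulrA -gauge_weight_sg; congr (_ *: _); ring.
Qed.

Lemma closed_loop T x s b : trajectory A B K W T x -> (forall i, well_timed (T i)) ->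
  0 <= b -> (b%:E < lifetime T)%E ->
  (forall t, t <= b -> t \notin s -> forall i k, T i k != t%:E) ->
  mx_derive s 0 b (gauged x)
    (fun t => A *m gauged x t - B *m K *m (gauged (xhat A T x) t *m LD)) /\
  mx_continuous s 0 b (gauged (xhat A T x)).
Proof.
move=> Tx Twt b0 bT sT.
have cx i : {within `[0, b], continuous (x i)}.
  have [c _] := Tx i; apply: continuous_subspaceW c => t /=.
  rewrite in_itv/= => /andP[-> tb]; split => //.
  by apply: le_lt_trans bT; rewrite lee_fin.
split; last first.
  move=> l i; under eq_fun do rewrite mxE.
  by apply: pw_continuousZ; exact: xhat_continuous.
move=> l i.
have dx : pw_derive s 0 b (fun t => x i t l 0)
    (fun t => (A *m x i t + B *m control A K W T x i t) l 0).
  split; first exact: within_entry.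
  move=> t /andP[t0 tb] ts; apply: is_derive_entry; apply: (Tx i).2 => //.
    by apply: le_lt_trans bT; rewrite lee_fin ltW.
  by move=> j k; exact: (sT t (ltW tb) ts).
apply: eq_pw_derive (pw_deriveZ (sigma i) dx) => [t|t _ _]; first by rewrite mxE.
transitivity ((sigma i *: (A *m x i t + B *m control A K W T x i t)) l 0).
  by rewrite [RHS]mxE.
rewrite scalerDr !scalemxAr gauge_control -col_gauged mulmxN.
rewrite -!col_mulmx [LHS]mxE [RHS]mxE; congr (_ + _); first by rewrite mxE.
by rewrite mxE [RHS]mxE mxE !mulmxA.
Qed.

Lemma trig_gE T x i t :
  let e := col i (gauged (xhat A T x) t - gauged x t) in
  let q := col i (gauged (xhat A T x) t *m LD) in
  trig_g A W sigma beta h T x i t = frob e e - beta i * frob q q - beta i * h t.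
Proof.
rewrite /trig_g /= !l2norm_sqr col_gauged_laplacian.
rewrite col_sub !col_gauged.
by under [X in _ = _ - _ * frob X _ - _]eq_bigr do rewrite !col_gauged;
   under [X in _ = _ - _ * frob _ X - _]eq_bigr do rewrite !col_gauged.
Qed.

End ClosedLoop.

(** * Minimal inter-event time and uniqueness of trajectories *)

Section Estimates.
Context {R : realType}.

(** Up to the contribution of the input, |X|^2 grows at most at this rate when
    X' = A X + G U; each of the two summands of X' costs one |X|^2 in Young's
    inequality. *)
Definition growth_rate {n} (A : 'M[R]_n) : R := 2 + opnorm A ^+ 2.

Lemma growth_rate_gt0 {n} (A : 'M[R]_n) : 0 < growth_rate A.
Proof. by rewrite ltr_pwDl// sqr_ge0. Qed.

Lemma frob_linear_derive {n m q} (A : 'M[R]_n) (G : 'M[R]_(n, m)) (X : 'M[R]_(n, q)) U :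
  frob (A *m X + G *m U) X + frob X (A *m X + G *m U) <=
  growth_rate A * frob X X + opnorm G ^+ 2 * frob U U.
Proof.
rewrite (frobC (_ + _)) frobDr.
have := frob_young X (A *m X) ltr01; have := frob_young X (G *m U) ltr01.
have := frob_opnorm A X; have := frob_opnorm G U; rewrite /growth_rate; lra.
Qed.

Lemma primitive_ge0_le s a b c t (g : R -> R) : pw_continuous s a b g ->
  (forall r, a < r < b -> 0 <= g r) -> a <= c -> c <= t -> t <= b ->
  primitive a g c <= primitive a g t.
Proof.
move=> gP g0 ac ct tb.
have ab : a <= b by rewrite (le_trans ac)// (le_trans ct).
have dg := pw_deriveW ac tb (pw_derive_primitive ab gP).
have := pw_derive_le ct (pw_derive_cst s c t 0) dg.
rewrite subrr subr_ge0; apply => r /andP[cr rt] _.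
by apply: g0; rewrite (le_lt_trans ac cr) (lt_le_trans rt tb).
Qed.

(** A sampling error e starts at zero and is driven by q only, so over a short
    interval its energy is a small fraction of that of q. Bounding the growth
    of |e|^2 by its maximum rather than by itself avoids exponentials. *)
Lemma sampling_error {n m} (A : 'M[R]_n) (G : 'M[R]_(n, m)) s a b e q : a <= b ->
  mx_derive s a b e (fun t => A *m e t + G *m q t) -> mx_continuous s a b q ->
  e a = 0 :> 'cV[R]_n -> growth_rate A * (b - a) <= 1 / 2 ->
  primitive a (fun t => frob (e t) (e t)) b <=
  2 * opnorm G ^+ 2 * (b - a) * primitive a (fun t => frob (q t) (q t)) b.
Proof.
move=> ab de cq ea Cab.
have dE := pw_derive_frob de de.
have cQ := pw_continuous_frob cq cq; have dQ := pw_derive_primitive ab cQ.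
have [t0 t0ab tmax] := EVT_max ab dE.1.
set M := frob (e t0) (e t0) in tmax; set Q := primitive a (fun t => frob (q t) (q t)) b.
have /andP[at0 t0b] : a <= t0 <= b by move: t0ab; rewrite in_itv.
have M0 : 0 <= M := frob_ge0 _.
have ME : forall t, a <= t <= b -> frob (e t) (e t) <= M.
  by move=> t tab; apply: tmax; rewrite in_itv.
have QQ : primitive a (fun t => frob (q t) (q t)) t0 <= Q.
  by apply: (primitive_ge0_le cQ) => // r _; exact: frob_ge0.
have Mle : M <= 2 * opnorm G ^+ 2 * Q.
  have dlin : pw_derive s a t0 (fun t => growth_rate A * M * t +
      opnorm G ^+ 2 * primitive a (fun t => frob (q t) (q t)) t)
      (fun t => growth_rate A * M * 1 + opnorm G ^+ 2 * frob (q t) (q t)).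
    apply: pw_deriveD; apply: pw_deriveZ; last exact: pw_deriveW dQ.
    by apply: is_derive_pw_derive => t; exact: is_derive_id.
  have growth : M <= growth_rate A * M * (t0 - a) +
      opnorm G ^+ 2 * primitive a (fun t => frob (q t) (q t)) t0.
    have := pw_derive_le at0 (pw_deriveW (lexx a) t0b dE) dlin.
    rewrite -/M ea frob0r subr0 primitive_start => H.
    apply: (le_trans (H _)); last by rewrite le_eqVlt; apply/orP; left; apply/eqP; ring.
    move=> t /andP[a_t tt0] _; apply: (le_trans (frob_linear_derive _ _ _ _)).
    rewrite mulr1 lerD2r ler_wpM2l ?(ltW (growth_rate_gt0 _))// ME//.
    by rewrite (ltW a_t) (le_trans (ltW tt0)).
  have : growth_rate A * M * (t0 - a) <= 1 / 2 * M.
    rewrite mulrAC ler_wpM2r//; apply: le_trans Cab.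
    by rewrite ler_wpM2l ?(ltW (growth_rate_gt0 _))// lerD2r.
  have := ler_wpM2l (sqr_ge0 (opnorm G)) QQ; lra.
have dM : pw_derive s a b (fun t => M * t) (fun t => M * 1).
  by apply: pw_deriveZ; apply: is_derive_pw_derive => t; exact: is_derive_id.
have cE := pw_continuous_frob (mx_derive_continuous de) (mx_derive_continuous de).
have := pw_derive_le ab (pw_derive_primitive ab cE) dM.
rewrite primitive_start subr0 => H; apply: (@le_trans _ _ (M * (b - a))).
  rewrite mulrBr; apply: H => t /andP[at_ tb] _.
  by rewrite mulr1 ME// (ltW at_) (ltW tb).
by rewrite [leRHS]mulrAC ler_wpM2r// subr_ge0.
Qed.

(** A linear equation with a delayed input has only the zero solution from
    zero data: on each step of a fixed length, the maximum of |D|^2 turns out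
    to be at most half of itself. *)
Lemma delay_uniqueness {n m N} (A : 'M[R]_n) (G : 'M[R]_(n, m)) s b
    (D : R -> 'M[R]_(n, N)) (U : R -> 'M[R]_(m, N)) C : 0 <= C ->
  mx_derive s 0 b D (fun t => A *m D t + G *m U t) -> D 0 = 0 ->
  (forall t M, 0 <= t <= b -> (forall r, 0 <= r <= t -> frob (D r) (D r) <= M) ->
    frob (U t) (U t) <= C * M) ->
  forall t, 0 <= t <= b -> D t = 0.
Proof.
move=> C0 dD D0 UD.
pose L := growth_rate A + opnorm G ^+ 2 * C.
have L0 : 0 < L by rewrite ltr_wpDr ?growth_rate_gt0// mulr_ge0// sqr_ge0.
have L20 : 0 < 2 * L by rewrite mulr_gt0.
have dE := pw_derive_frob dD dD.
suff step k : forall t, 0 <= t <= b -> t <= k%:R / (2 * L) -> frob (D t) (D t) = 0.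
  move=> t tb; apply: frob_eq0; apply: (step (Num.truncn (t * (2 * L))).+1) => //.
  by rewrite ler_pdivlMr// ltW// truncnS_gt.
elim: k => [|k IH] t /andP[t0 tb] tk.
  by rewrite (_ : t = 0) ?D0 ?frob0r//; apply/eqP; rewrite eq_le t0 andbT -[leRHS](mul0r (2 * L)^-1).
have dEt := pw_deriveW (lexx 0) tb dE.
have [t1 t1t tmax] := EVT_max t0 dEt.1.
set M := frob (D t1) (D t1) in tmax.
have /andP[t10 t1t'] : 0 <= t1 <= t by move: t1t; rewrite in_itv.
have M0 : 0 <= M := frob_ge0 _.
have ME r : 0 <= r <= t -> frob (D r) (D r) <= M by move=> rt; apply: tmax; rewrite in_itv.
suff : M <= 0.
  move=> M0'; apply/eqP; rewrite eq_le frob_ge0 andbT.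
  by apply: le_trans M0'; rewrite ME// t0 lexx.
pose c := k%:R / (2 * L).
have c0 : 0 <= c by rewrite divr_ge0// ltW.
have [t1c|ct1] := leP t1 c; first by rewrite /M IH// t10 (le_trans t1t').
have Ec : frob (D c) (D c) = 0 by apply: IH => //; rewrite c0 (le_trans (ltW ct1))// (le_trans t1t').
have dlin : pw_derive s c t1 (fun t => L * M * t) (fun t => L * M * 1).
  by apply: pw_deriveZ; apply: is_derive_pw_derive => r; exact: is_derive_id.
have : M <= L * M * (t1 - c).
  have := pw_derive_le (ltW ct1) (pw_deriveW c0 t1t' dEt) dlin.
  rewrite -/M Ec subr0 mulrBr; apply => r /andP[cr rt1] _.
  have r0 : 0 <= r by rewrite (le_trans c0)// ltW.
  have rt : r <= t by rewrite (le_trans (ltW rt1)).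
  apply: (le_trans (frob_linear_derive _ _ _ _)).
  rewrite mulr1 /L [leRHS]mulrDl lerD//.
    by rewrite ler_wpM2l ?(ltW (growth_rate_gt0 _))// ME// r0.
  rewrite -mulrA ler_wpM2l ?sqr_ge0//; apply: UD; first by rewrite r0 (le_trans rt).
  by move=> u /andP[u0 ur]; rewrite ME// u0 (le_trans ur).
have : t1 - c <= 1 / (2 * L).
  by rewrite lerBlDr -mulrDl addrC natr1 (le_trans t1t').
move=> /(ler_wpM2l (mulr_ge0 (ltW L0) M0)).
have -> : L * M * (1 / (2 * L)) = M / 2 by field; rewrite gt_eqF.
lra.
Qed.

End Estimates.

(** * The event-triggered system *)

Section EventTriggered.
Context {R : realType} {N n m : nat}.
Variables (A : 'M[R]_n) (B : 'M[R]_(n, m)) (K : 'M[R]_(m, n)) (W : 'M[R]_N).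
Variables (sigma beta : 'I_N -> R) (h : R -> R).
Hypothesis Wsym : W^T = W.
Hypothesis sigma1 : forall i, sigma i = 1 \/ sigma i = -1.
Hypothesis Wgauge : forall i j, 0 <= (gauge_mx sigma *m W *m gauge_mx sigma) i j.
Hypothesis hcont : {within `[0, +oo[, continuous h}.
Hypothesis h0 : forall t, 0 <= t -> 0 < h t.
Hypothesis beta0 : forall i, 0 < beta i.

Local Notation LD := (gauged_laplacian W sigma).

Lemma threshold_pw_continuous s a b : 0 <= a -> pw_continuous s a b h.
Proof.
move=> a0; apply: within_pw_continuous; apply: continuous_subspaceW hcont => t /=.
by rewrite !in_itv/= andbT => /andP[at_ _]; exact: le_trans at_.
Qed.

Lemma col_gauged_xhat T x t i : let c := last_instant (T i) t in
  col i (gauged sigma (xhat A T x) t) = mxexp ((t - c) *: A) *m col i (gauged sigma x c).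
Proof. by rewrite /= !col_gauged /xhat scalemxAr. Qed.

(** While agent i does not trigger, its error is a sampling error in the sense
    of sampling_error, driven by the very quantity that the triggering rule
    compares it with. *)
Lemma no_early_trigger T x i k a t : (forall j, well_timed (T j)) ->
  trajectory A B K W T x -> T i k = a%:E -> T i k.+1 = +oo%E ->
  a < t -> (t%:E < lifetime T)%E ->
  growth_rate A * (t - a) <= 1 / 2 -> 2 * opnorm (B *m K) ^+ 2 * (t - a) <= beta i ->
  trig_f A W sigma beta h T x i k t <= 0.
Proof.
move=> Twt Tx Ta Too a_t tT t_growth t_beta.
have a0 : 0 <= a by rewrite -lee_fin -Ta instant_ge0.
have t0 : 0 <= t by rewrite (le_trans a0)// ltW.
have [s sT] := all_instants_finite Twt tT.
have [dZ cZh] := closed_loop Wsym sigma1 Wgauge Tx Twt t0 tT sT.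
pose Z := gauged sigma x; pose Zh := gauged sigma (xhat A T x).
pose q r := col i (Zh r *m LD).
pose eh r := mxexp ((r - a) *: A) *m col i (Z a).
pose e r := eh r - col i (Z r).
have ZhE r : a <= r -> col i (Zh r) = eh r.
  move=> ar; rewrite /Zh col_gauged_xhat (@last_instantE _ _ (Twt i) k) ?Ta ?lee_fin//.
  by rewrite Too ltry.
have de : mx_derive s a t e (fun r => A *m e r + B *m K *m q r).
  apply: eq_mx_derive (mx_deriveB (mx_derive_flow s a t A (col i (Z a)) a)
    (mx_derive_col i (mx_deriveW a0 (lexx t) dZ))) => [//|r _ _].
  by rewrite col_sub (col_mulmx A) (col_mulmx (B *m K)) /e mulmxBr opprB addrA addrAC.
have cq : mx_continuous s a t q.
  exact/mx_continuous_col/mx_continuous_mulr/(mx_continuousW a0 (lexx t)).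
have ea : e a = 0 by rewrite /e /eh subrr mxexp0 mul1mx subrr.
have small := sampling_error (ltW a_t) de cq ea t_growth.
have cE := pw_continuous_frob (mx_derive_continuous de) (mx_derive_continuous de).
have cQ := pw_continuous_frob cq cq.
have ch := threshold_pw_continuous s t a0.
pose g r := frob (e r) (e r) - beta i * frob (q r) (q r) - beta i * h r.
have cg : pw_continuous s a t g.
  by apply: pw_continuousB; [apply: pw_continuousB|] => //; exact: pw_continuousZ.
have -> : trig_f A W sigma beta h T x i k t = primitive a g t.
  rewrite /trig_f Ta; apply: eq_Rintegral => r; rewrite inE/= in_itv/= => /andP[ar rt].
  by rewrite trig_gE// /g /e -ZhE// -col_sub.
have at' := ltW a_t.
have dG := pw_derive_primitive at' cg.
have dQ := pw_deriveZ (beta i) (pw_derive_primitive at' cQ).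
have := pw_derive_le at' dG (pw_deriveB (pw_derive_primitive at' cE) dQ).
rewrite !primitive_start mulr0 !subr0 => /(_ _)/le_trans; apply.
  move=> r /andP[ar rt] _; rewrite /g gerBl.
  by rewrite mulr_ge0 ?(ltW (beta0 i))// ltW// h0// (le_trans a0)// ltW.
rewrite subr_le0; apply: (le_trans small); rewrite ler_wpM2r//.
have := primitive_ge0_le cQ (fun r _ => frob_ge0 (q r)) (lexx a) at' (lexx t).
by rewrite primitive_start.
Qed.

Section Consequences.
Variables (T : instants R N) (x : signal R N n).
Hypothesis Tx : event_triggered A B K W sigma beta h T x.

Lemma event_well_timed i : well_timed (T i).
Proof.
have [_ T0 Tk] := Tx; split => // k; have [y [_ _ ->]] := Tk i k.
by apply: le_ereal_inf_tmp => _ [t [/= /ltW Tt _ _] <-].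
Qed.

Lemma beta_lower_bound : exists2 b : R, 0 < b & forall i, b <= beta i.
Proof.
exists (\big[Num.min/1]_i beta i); first exact: lt_bigmin.
by move=> i; exact: bigmin_le_cond.
Qed.

(** The two bounds on tau are those under which no_early_trigger applies, with
    b a common lower bound of the beta_i. *)
Lemma min_inter_event : exists2 tau : R, 0 < tau &
  forall i k, (T i k < +oo)%E -> (T i k + tau%:E <= T i k.+1)%E.
Proof.
have [b b0 bbeta] := beta_lower_bound.
pose C := 2 * opnorm (B *m K) ^+ 2 + 1.
have C0 : 0 < C by rewrite ltr_wpDl// mulr_ge0// sqr_ge0.
pose L := growth_rate A; have L0 : 0 < L := growth_rate_gt0 A.
exists (Num.min (1 / (2 * L)) (b / C)).
  by rewrite lt_min !divr_gt0// mulr_gt0.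
move=> i k Tfin; have Twt := event_well_timed.
have [_ _ /(_ i k)[y [Ty _ ->]]] := Tx.
apply: le_ereal_inf_tmp => _ [t [/= Tt tT f0] <-].
rewrite leNgt; apply/negP => t_tau; move: f0; apply/negP; rewrite -leNgt.
have TE := instant_fin (Twt i) (ltW Tt).
move: t_tau Tt; rewrite TE -EFinD !lte_fin -ltrBlDl lt_min => /andP[tL tC] a_t.
have ta0 : 0 <= t - fine (T i k) by rewrite subr_ge0 ltW.
apply: (no_early_trigger (stop_after_well_timed i k Twt) Ty (a := fine (T i k))) => //.
- by rewrite /stop_after eqxx ltnn.
- by rewrite /stop_after eqxx ltnSn.
- by rewrite mulrC -ler_pdivlMr//; move: tL; rewrite mul1r invfM => /ltW; rewrite div1r mulrC.
- apply: le_trans (bbeta i); apply: (@le_trans _ _ (C * (t - fine (T i k)))).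
    by rewrite ler_wpM2r// lerDl.
  by rewrite mulrC -ler_pdivlMr// ltW.
Qed.

(** The k-th instant of an agent is not before k tau, so no agent has
    infinitely many instants in bounded time. *)
Lemma event_lifetime : lifetime T = +oo%E.
Proof.
have [tau tau0 Ttau] := min_inter_event.
apply/eqP; rewrite -leye_eq; apply: le_ereal_inf_tmp => _ [i _ <-].
have H k : ((k%:R * tau)%:E <= T i k)%E.
  elim: k => [|k IH]; first by rewrite mul0r; have [-> _] := event_well_timed i.
  have [Tk|] := ltP (T i k) +oo%E.
    apply: le_trans (Ttau i k Tk); rewrite -natr1 mulrDl mul1r EFinD.
    by rewrite leeD2r.
  rewrite leye_eq => /eqP Tk; have [_ /(_ k)] := event_well_timed i.
  by rewrite Tk => /(le_trans _); apply; rewrite leey.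
rewrite leye_eq; apply/eqP/eqyP => r r0.
apply: le_ereal_sup_tmp; exists (T i (Num.truncn (r / tau)).+1); first by exists (Num.truncn (r / tau)).+1.
apply: le_trans (H _); rewrite lee_fin -ler_pdivrMr// ltW//.
exact: truncnS_gt.
Qed.

Lemma stop_after_lifetime i k : lifetime (stop_after T i k) = +oo%E.
Proof.
apply/eqP; rewrite -leye_eq -event_lifetime; apply: le_ereal_inf_tmp => _ [j _ <-].
apply: (@le_trans _ _ (ereal_sup (range (T j)))).
  by apply: ereal_inf_lbound; exists j.
apply: ge_ereal_sup => _ [l _ <-]; apply: le_ereal_sup_tmp.
exists (stop_after T i k j l); first by exists l.
by rewrite /stop_after; case: ifP => // _; rewrite leey.
Qed.

(** The difference of two trajectories with the same sampling times solves a
    linear equation whose input is its own past, transported by e^(tA). *)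
Lemma trajectory_unique T1 x1 T2 x2 b : 0 <= b ->
  (forall j, well_timed (T1 j)) -> (forall j, well_timed (T2 j)) ->
  trajectory A B K W T1 x1 -> trajectory A B K W T2 x2 ->
  (b%:E < lifetime T1)%E -> (b%:E < lifetime T2)%E ->
  (forall j, x1 j 0 = x2 j 0) ->
  (forall j t, 0 <= t <= b -> last_instant (T1 j) t = last_instant (T2 j) t) ->
  forall t, 0 <= t <= b -> gauged sigma x1 t = gauged sigma x2 t.
Proof.
move=> b0 wt1 wt2 tr1 tr2 b1 b2 x0 lastE.
have [s1 s1P] := all_instants_finite wt1 b1.
have [s2 s2P] := all_instants_finite wt2 b2.
have notin t : t \notin s1 ++ s2 -> t \notin s1 /\ t \notin s2.
  by rewrite mem_cat negb_or => /andP.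
have [d1 _] := closed_loop Wsym sigma1 Wgauge tr1 wt1 b0 b1
  (fun t tb ts => s1P t tb (notin t ts).1).
have [d2 _] := closed_loop Wsym sigma1 Wgauge tr2 wt2 b0 b2
  (fun t tb ts => s2P t tb (notin t ts).2).
have [Ce HCe] := frob_mxexp_bounded A b.
have Ce0 : 0 <= Ce by apply: le_trans (frob_ge0 _) (HCe 0 _); rewrite lexx.
pose D t := gauged sigma x1 t - gauged sigma x2 t.
pose Dh t := gauged sigma (xhat A T1 x1) t - gauged sigma (xhat A T2 x2) t.
have dD : mx_derive (s1 ++ s2) 0 b D (fun t => A *m D t + (- (B *m K)) *m (Dh t *m LD)).
  apply: eq_mx_derive (mx_deriveB d1 d2) => [//|t _ _].
  have E (a p c q : 'M[R]_(n, N)) : a - p - (c - q) = a - c - (p - q).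
    by rewrite !opprB addrACA [RHS]addrACA [- p - c]addrC.
  by rewrite /D /Dh mulNmx (mulmxBl _ _ LD) !mulmxBr E.
have DhD t M : 0 <= t <= b -> (forall r, 0 <= r <= t -> frob (D r) (D r) <= M) ->
    frob (Dh t *m LD) (Dh t *m LD) <= opnorm LD^T ^+ 2 * (N%:R * Ce) * M.
  move=> tb DM; have /andP[t0 tb'] := tb.
  rewrite -mulrA; apply: (le_trans (frob_opnormr _ _)); rewrite ler_wpM2l ?sqr_ge0//.
  rewrite frob_col -mulrA mulr_natl -[N in leRHS]card_ord -sumr_const; apply: ler_sum => j _.
  have tT1 : (t%:E < lifetime T1)%E by apply: le_lt_trans b1; rewrite lee_fin.
  have /andP[c0 ct] := last_instant_itv (wt1 j) t0 (lt_lifetime tT1 j).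
  have -> : col j (Dh t) = mxexp ((t - last_instant (T1 j) t) *: A) *m
      col j (D (last_instant (T1 j) t)).
    by rewrite !col_sub !col_gauged_xhat -lastE// mulmxBr.
  apply: (le_trans (frob_mulmx_le _ _)); apply: ler_pM; rewrite ?frob_ge0//.
    by apply: HCe; rewrite subr_ge0 ct lerBlDr (le_trans tb')// lerDl.
  apply: le_trans (DM (last_instant (T1 j) t) _); last by rewrite c0.
  by rewrite [leRHS]frob_col (bigD1 j)//= lerDl sumr_ge0// => k _; exact: frob_ge0.
move=> t tb; apply/eqP; rewrite -subr_eq0; apply/eqP.
have C0 : 0 <= opnorm LD^T ^+ 2 * (N%:R * Ce) by rewrite mulr_ge0 ?sqr_ge0// mulr_ge0.
apply: (delay_uniqueness C0 dD _ DhD tb).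
by apply/matrixP => l j; rewrite /D !mxE x0 subrr.
Qed.

Lemma last_instant_stop_after i k j t : (t%:E < T i k.+1)%E ->
  last_instant (stop_after T i k j) t = last_instant (T j) t.
Proof.
move=> tT; rewrite /last_instant; congr (fine (ereal_sup _)).
have E l : (T j l <= t%:E)%E -> stop_after T i k j l = T j l.
  rewrite /stop_after; case: ifP => // /andP[/eqP -> kl] /le_lt_trans/(_ tT).
  by rewrite ltNge (instant_le (event_well_timed i) kl).
have E' l : (stop_after T i k j l <= t%:E)%E -> stop_after T i k j l = T j l.
  by rewrite /stop_after; case: ifP => // _; rewrite leNgt ltry.
apply/seteqP; split => _ [l /= lt <-]; exists l => /=.
- by rewrite -E'.
- by rewrite E'.
- by rewrite E.
- by rewrite E.
Qed.

(** Before the next instant of agent i, the stopped signals that define the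
    triggering function coincide with the actual ones. *)
Lemma trig_integral_le0 i k t : (T i k <= t%:E)%E -> (t%:E < T i k.+1)%E ->
  \int[lebesgue_measure]_(r in `[fine (T i k), t]) trig_g A W sigma beta h T x i r <= 0.
Proof.
move=> Tt tT; have Twt := event_well_timed; have TE := instant_fin (Twt i) Tt.
have a0 : 0 <= fine (T i k) by rewrite -lee_fin -TE instant_ge0.
move: (Tt); rewrite le_eqVlt => /predU1P[Tt_eq|Tt_lt].
  by rewrite Tt_eq/= set_itv1 Rintegral_set1.
have [tr _ /(_ i k)[y [Ty y0 Tnext]]] := Tx.
have t0 : 0 <= t by rewrite (le_trans a0)// -lee_fin -TE.
have wt' := stop_after_well_timed i k Twt.
have lastE j r : 0 <= r <= t -> last_instant (T j) r = last_instant (stop_after T i k j) r.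
  move=> /andP[_ rt]; rewrite last_instant_stop_after//.
  by apply: le_lt_trans tT; rewrite lee_fin.
have xy : forall r, 0 <= r <= t -> gauged sigma x r = gauged sigma y r.
  apply: (trajectory_unique t0 Twt wt' tr Ty) => //.
  - by rewrite event_lifetime ltry.
  - by rewrite stop_after_lifetime ltry.
have -> : \int[lebesgue_measure]_(r in `[fine (T i k), t]) trig_g A W sigma beta h T x i r
    = trig_f A W sigma beta h (stop_after T i k) y i k t.
  rewrite /trig_f (_ : stop_after T i k i k = T i k); last by rewrite /stop_after eqxx ltnn.
  apply: eq_Rintegral => r.
  rewrite inE/= in_itv/= => /andP[ar rt].
  have rb : 0 <= r <= t by rewrite rt (le_trans a0).
  rewrite !trig_gE// (xy r rb).
  suff -> : gauged sigma (xhat A T x) r = gauged sigma (xhat A (stop_after T i k) y) r by [].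
  apply/matrixP => l j; have /andP[r0 _] := rb.
  have rT : (r%:E < lifetime T)%E by rewrite event_lifetime ltry.
  have /andP[c0 cr] := last_instant_itv (Twt j) r0 (lt_lifetime rT j).
  have := col_gauged_xhat T x r j; rewrite /= xy; last by rewrite c0 (le_trans cr).
  rewrite (lastE j r rb) -col_gauged_xhat => /matrixP/(_ l 0).
  by rewrite !mxE.
rewrite leNgt; apply/negP => f0; move: tT; apply/negP; rewrite -leNgt Tnext.
apply: ereal_inf_lbound; exists t => //; split => //.
by rewrite stop_after_lifetime ltry.
Qed.

End Consequences.
End EventTriggered.

(** * The Lyapunov inequality *)

Section Lyapunov.
Context {R : realType} {N n m : nat}.
Variables (A : 'M[R]_n) (B : 'M[R]_(n, m)) (W : 'M[R]_N) (sigma : 'I_N -> R).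
Variables (P : 'M[R]_n) (alpha kappa c : R).
Hypothesis Wsym : W^T = W.
Hypothesis Wconn : graph_connected W.
Hypothesis sigma1 : forall i, sigma i = 1 \/ sigma i = -1.
Hypothesis Wgauge : forall i j, 0 <= (gauge_mx sigma *m W *m gauge_mx sigma) i j.
Hypothesis alphaP : smallest_pos_eigenvalue (laplacian W) alpha.
Hypothesis Ppos : posdefmx P.
Hypothesis riccati :
  posdefmx (- kappa%:M - (A^T *m P + P *m A - alpha *: (P *m B *m B^T *m P))).
Hypothesis c0 : 0 < c.

Local Notation LD := (gauged_laplacian W sigma).
Local Notation S := (P *m B *m B^T *m P).

(** The projection that subtracts the average over the agents. *)
Definition centering : 'M[R]_N := 1%:M - N%:R^-1 *: const_mx 1.

Lemma mulmx_centeringE p (X : 'M[R]_(p, N)) l i :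
  (X *m centering) l i = X l i - N%:R^-1 * \sum_k X l k.
Proof.
rewrite /centering mulmxBr mulmx1 -scalemxAr mxE [X in _ + X]mxE; congr (_ - _).
by rewrite !mxE; congr (_ * _); apply: eq_bigr => k _; rewrite mxE mulr1.
Qed.

Lemma centering_sum0 p (X : 'M[R]_(p, N)) l : \sum_i (X *m centering) l i = 0.
Proof.
under eq_bigr do rewrite mulmx_centeringE.
rewrite sumrB sumr_const card_ord -[X in _ - X]mulr_natl mulrA.
have [N0|N0] := eqVneq (N%:R : R) 0.
  rewrite N0 !mul0r subr0 big1// => i _; move/eqP: N0; rewrite pnatr_eq0.
  by rewrite -leqn0 leqNgt (leq_ltn_trans (leq0n i) (ltn_ord i)).
by rewrite divff// mul1r subrr.
Qed.

Lemma laplacian_centering : LD *m centering = LD.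
Proof.
apply/matrixP => l i; rewrite mulmx_centeringE.
have -> : \sum_k LD l k = \sum_k LD k l.
  by apply: eq_bigr => k _; rewrite -{1}(gauged_laplacian_sym Wsym sigma1 Wgauge) mxE.
by rewrite gauged_laplacian_sum0// mulr0 subr0.
Qed.

Lemma centering_laplacian : centering *m LD = LD.
Proof.
have csym : centering^T = centering.
  by apply/matrixP => i j; rewrite !mxE eq_sym.
apply: trmx_inj; rewrite trmx_mul csym gauged_laplacian_sym//.
exact: laplacian_centering.
Qed.

Lemma posdef_frob (M : 'M[R]_n) p (X : 'M[R]_(n, p)) : posdefmx M -> 0 <= frob X (M *m X).
Proof.
move=> [_ Mpos].
have -> : frob X (M *m X) = \sum_j frob (col j X) (M *m col j X).
  rewrite /frob exchange_big; apply: eq_bigr => j _.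
  by rewrite -col_mulmx; apply: eq_bigr => i _; rewrite big_ord1 !mxE.
apply: sumr_ge0 => j _; have [->|v0] := eqVneq (col j X) 0; first by rewrite mulmx0 frob0r.
by rewrite frob_trace trace_mx11 mulmxA ltW// Mpos.
Qed.

(** The Riccati inequality only controls the feedback term up to alpha S; the
    spectral gap recovers it on centered states, where L_D is at least alpha.
    The remaining cross term is absorbed by Young's inequality with weight c. *)
Lemma lyapunov_decay (D E D' : 'M[R]_(n, N)) : (forall l, \sum_j D l j = 0) ->
  D' = A *m D - B *m (B^T *m P) *m ((D + E) *m LD) ->
  frob D' (P *m D) + frob D (P *m D') <=
  - (kappa - c * opnorm (LD *t S) ^+ 2) * frob D D + frob E E / c.
Proof.
move=> D_sum D'E; have [Psym _] := Ppos.
have LDsym := gauged_laplacian_sym Wsym sigma1 Wgauge.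
have -> : frob D' (P *m D) + frob D (P *m D') = 2 * frob D' (P *m D).
  by rewrite [X in _ + X]frobC frob_mull Psym; ring.
have fA : 2 * frob (A *m D) (P *m D) = frob D ((A^T *m P + P *m A) *m D).
  have PA : frob D (P *m (A *m D)) = frob (A *m D) (P *m D).
    by rewrite frobC frob_mull Psym.
  by rewrite mulmxDl frobDr -!mulmxA PA -frob_mull; ring.
have SE p (Y : 'M[R]_(n, p)) : S *m Y = (B^T *m P)^T *m ((B^T *m P) *m Y).
  by rewrite trmx_mul trmxK Psym !mulmxA.
have fB Y : frob (B *m (B^T *m P) *m Y) (P *m D) = frob Y (S *m D).
  by rewrite frob_mull !trmx_mul trmxK Psym !mulmxA.
pose CD := B^T *m P *m D.
have fS : frob D (S *m D) = frob CD CD by rewrite SE -frob_mull.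
have fSL : frob (D *m LD) (S *m D) = frob CD (CD *m LD).
  by rewrite SE -frob_mull mulmxA frobC.
have gap : alpha * frob CD CD <= frob CD (CD *m LD).
  apply: spectral_gap => // l; under eq_bigr do rewrite mxE.
  by rewrite exchange_big big1//= => k _; rewrite -mulr_sumr D_sum mulr0.
have alpha_ge0 : 0 <= alpha * frob CD CD.
  by have [/ltW alpha0 _ _] := alphaP; rewrite mulr_ge0// frob_ge0.
have := posdef_frob D riccati.
rewrite !mulmxBl mulNmx mul_scalar_mx -scalemxAl !(frobBr, frobNr, frobZr) fS -fA => ric.
have cross : - (2 * frob (E *m LD) (S *m D)) <=
    c * opnorm (LD *t S) ^+ 2 * frob D D + frob E E / c.
  rewrite frob_mulr frobC -mulrN -frobNr.
  apply: (le_trans (frob_young _ _ c0)); rewrite frobNl frobNr opprK lerD2r -mulrA.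
  by rewrite ler_wpM2l ?(ltW c0)// frob_tens.
rewrite D'E frobBl fB mulmxDl frobDl fSL; lra.
Qed.

End Lyapunov.

(** * Bipartite consensus *)

Section Consensus.
Context {R : realType} {N n m : nat}.
Variables (A : 'M[R]_n) (B : 'M[R]_(n, m)) (W : 'M[R]_N).
Variables (sigma beta : 'I_N -> R) (h : R -> R).
Variables (P : 'M[R]_n) (alpha kappa c : R) (T : instants R N) (x : signal R N n).
Hypothesis Wsym : W^T = W.
Hypothesis Wconn : graph_connected W.
Hypothesis sigma1 : forall i, sigma i = 1 \/ sigma i = -1.
Hypothesis Wgauge : forall i j, 0 <= (gauge_mx sigma *m W *m gauge_mx sigma) i j.
Hypothesis alphaP : smallest_pos_eigenvalue (laplacian W) alpha.
Hypothesis hcont : {within `[0, +oo[, continuous h}.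
Hypothesis h0 : forall t, 0 <= t -> 0 < h t.
Hypothesis hint : (\int[lebesgue_measure]_(s in `[0%R, +oo[) (h s)%:E = 1)%E.
Hypothesis Ppos : posdefmx P.
Hypothesis riccati :
  posdefmx (- kappa%:M - (A^T *m P + P *m A - alpha *: (P *m B *m B^T *m P))).
Hypothesis beta0 : forall i, 0 < beta i.
Hypothesis c0 : 0 < c.

Local Notation LD := (gauged_laplacian W sigma).
Local Notation K := (B^T *m P).
Local Notation beta_max := (\big[Num.max/0]_i beta i).
Local Notation bet := (kappa - c * opnorm (LD *t (P *m B *m B^T *m P)) ^+ 2).

Hypothesis bet0 : 0 < bet.
Hypothesis beta_small : beta_max < Num.min (1 / (2 * opnorm LD ^+ 2))
                     (bet * c / (2 * opnorm LD ^+ 2 * (bet * c + 1))).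
Hypothesis Tx : event_triggered A B K W sigma beta h T x.

Let Z := gauged sigma x.
Let Zh := gauged sigma (xhat A T x).
Let E t := Zh t - Z t.
Let Q t := Zh t *m LD.
Let D t := Z t *m centering.
Let energyE t := frob (E t) (E t).
Let energyQ t := frob (Q t) (Q t).
Let energyD t := frob (D t) (D t).
Let G t := primitive 0 energyD t + primitive 0 energyE t.
Let g i := trig_g A W sigma beta h T x i.

Lemma gE i r : g i r = frob (col i (E r)) (col i (E r)) -
  beta i * frob (col i (Q r)) (col i (Q r)) - beta i * h r.
Proof. exact: trig_gE. Qed.

Lemma closed_loop_on b : 0 <= b -> exists s,
  mx_derive s 0 b Z (fun t => A *m Z t - B *m K *m Q t) /\ mx_continuous s 0 b Zh.
Proof.
move=> b_ge0; have Twt := event_well_timed Tx; have [tr _ _] := Tx.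
have bT : (b%:E < lifetime T)%E by rewrite (event_lifetime Wsym sigma1 Wgauge hcont h0 beta0 Tx) ltry.
have [s sT] := all_instants_finite Twt bT.
by exists s; exact: closed_loop.
Qed.

Lemma energies_pw_continuous s b : 0 <= b ->
  mx_derive s 0 b Z (fun t => A *m Z t - B *m K *m Q t) -> mx_continuous s 0 b Zh ->
  [/\ pw_continuous s 0 b energyE, pw_continuous s 0 b energyQ,
      pw_continuous s 0 b energyD & forall i, pw_continuous s 0 b (g i)].
Proof.
move=> b_ge0 dZ cZh; have cZ := mx_derive_continuous dZ.
have cE : mx_continuous s 0 b E by exact: mx_continuousB.
have cQ : mx_continuous s 0 b Q by exact: mx_continuous_mulr.
split; try exact: pw_continuous_frob.
  by apply: pw_continuous_frob; exact: mx_continuous_mulr.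
move=> i; have -> : g i = fun r => frob (col i (E r)) (col i (E r)) -
    beta i * frob (col i (Q r)) (col i (Q r)) - beta i * h r.
  by apply/funext => r; exact: gE.
apply: pw_continuousB; last exact/pw_continuousZ/threshold_pw_continuous.
apply: pw_continuousB; last apply: pw_continuousZ.
  by apply: pw_continuous_frob; exact: mx_continuous_col.
by apply: pw_continuous_frob; exact: mx_continuous_col.
Qed.

(** The triggering rule keeps the running integral of the triggering function
    nonpositive between two instants, hence from time zero on. *)
Lemma agent_budget i t : 0 <= t -> primitive 0 (g i) t <= 0.
Proof.
move=> t0; have Twt := event_well_timed Tx.
have Tlife := event_lifetime Wsym sigma1 Wgauge hcont h0 beta0 Tx.
have [tau tau0 Ttau] := min_inter_event Wsym sigma1 Wgauge hcont h0 beta0 Tx.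
have step k r : (T i k <= r%:E)%E -> (r%:E < T i k.+1)%E ->
    primitive 0 (g i) r <= primitive 0 (g i) (fine (T i k)).
  move=> Tr rT; rewrite -subr_le0.
  have TE := instant_fin (Twt i) Tr.
  have a0 : 0 <= fine (T i k) by rewrite -lee_fin -TE instant_ge0.
  have ar : fine (T i k) <= r by rewrite -lee_fin -TE.
  have r0 := le_trans a0 ar.
  have [s [dZ cZh]] := closed_loop_on r0.
  have [_ _ _ /(_ i) cg] := energies_pw_continuous r0 dZ cZh.
  rewrite -(Rintegral_primitive cg a0 ar (lexx r)).
  exact: (trig_integral_le0 Wsym sigma1 Wgauge hcont h0 beta0 Tx Tr rT).
have nodes k : (T i k < +oo)%E -> primitive 0 (g i) (fine (T i k)) <= 0.
  elim: k => [|k IH] Tk; first by have [-> _] := Twt i; rewrite /= primitive_start.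
  have Tk' : (T i k < +oo)%E by apply: le_lt_trans Tk; have [_] := Twt i.
  have bE : T i k.+1 = (fine (T i k.+1))%:E.
    by rewrite fineK// fin_numElt Tk (lt_le_trans _ (instant_ge0 (Twt i) _)) ?ltNy0.
  have aE : T i k = (fine (T i k))%:E.
    by rewrite fineK// fin_numElt Tk' (lt_le_trans _ (instant_ge0 (Twt i) _)) ?ltNy0.
  move: (Ttau i k Tk'); rewrite aE bE -EFinD lee_fin.
  set a := fine _; set b := fine _ => ab'.
  have ab : a < b by rewrite (lt_le_trans _ ab')// ltrDl.
  have a0 : 0 <= a by rewrite -lee_fin -aE instant_ge0.
  have b_ge0 : 0 <= b by rewrite (le_trans a0)// ltW.
  have [s [dZ cZh]] := closed_loop_on b_ge0.
  have [_ _ _ /(_ i) cg] := energies_pw_continuous b_ge0 dZ cZh.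
  have [cG _] := pw_deriveW a0 (lexx b) (pw_derive_primitive b_ge0 cg).
  have /(continuous_within_itvP _ ab)[_ _ Gb] := cG.
  apply: (cvgr_to_le Gb); near=> r.
  have ar : a < r by near: r; exact: nbhs_left_gt.
  have rb : r < b by near: r; exact: nbhs_left_lt.
  apply: le_trans (IH Tk'); apply: step; first by rewrite aE lee_fin ltW.
  by rewrite bE lte_fin.
have tT : (t%:E < lifetime T)%E by rewrite Tlife ltry.
have [k [Tt tTk]] := instant_index (Twt i) t0 (lt_lifetime tT i).
apply: (le_trans (step k t Tt tTk)); apply: nodes.
by apply: le_lt_trans Tt _; rewrite ltry.
Unshelve. all: by end_near. Qed.

Lemma threshold_mass t : 0 <= t -> primitive 0 h t <= 1.
Proof.
move=> t0; rewrite /primitive /Rintegral.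
have H : (\int[lebesgue_measure]_(r in `[0%R, t]) (h r)%:E <= 1)%E.
  rewrite -hint; apply: ge0_subset_integral => //.
  - by apply/measurable_EFinP; exact: subspace_continuous_measurable_fun.
  - by move=> r /=; rewrite in_itv/= andbT => r0; rewrite lee_fin ltW// h0.
  - by apply: subset_itvl; rewrite bnd_simp.
move: H; case: (\int[lebesgue_measure]_(r in `[0%R, t]) (h r)%:E)%E => [r||] //=.
Qed.

(** The sum of the agent budgets; the threshold h costs at most the sum of the
    beta_i because its total mass is one. *)
Lemma network_budget t : 0 <= t ->
  primitive 0 energyE t <= beta_max * primitive 0 energyQ t + \sum_i beta i.
Proof.
move=> t0; have [s [dZ cZh]] := closed_loop_on t0.
have [cE cQ _ cg] := energies_pw_continuous t0 dZ cZh.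
have ch : pw_continuous s 0 t h by exact: threshold_pw_continuous.
have dG := pw_derive_sum (fun i => pw_derive_primitive t0 (cg i)).
have dF := pw_deriveB (pw_deriveB (pw_derive_primitive t0 cE)
  (pw_deriveZ beta_max (pw_derive_primitive t0 cQ)))
  (pw_deriveZ (\sum_i beta i) (pw_derive_primitive t0 ch)).
have sum0 : \sum_i primitive 0 (g i) 0 = 0.
  by apply: big1 => i _; exact: primitive_start.
have := pw_derive_le t0 dF dG; rewrite sum0 !primitive_start !mulr0 !subr0 => H.
have sumG : \sum_i primitive 0 (g i) t <= 0 by apply: sumr_le0 => i _; exact: agent_budget.
have mass := threshold_mass t0.
have sb0 : 0 <= \sum_i beta i by apply: sumr_ge0 => i _; exact: ltW.
suff : primitive 0 energyE t - beta_max * primitive 0 energyQ t -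
    (\sum_i beta i) * primitive 0 h t <= \sum_i primitive 0 (g i) t.
  by have := ler_wpM2l sb0 mass; lra.
apply: H => r /andP[r0 rt] _.
rewrite (eq_bigr _ (fun i _ => gE i r)).
rewrite !sumrB -mulr_suml lerB// /energyE frob_col lerB//.
rewrite /energyQ frob_col mulr_sumr; apply: ler_sum => i _.
by rewrite ler_wpM2r ?frob_ge0// le_bigmax.
Qed.

Lemma QE t : Q t = (D t + E t) *m LD.
Proof.
rewrite mulmxDl /D -mulmxA (centering_laplacian Wsym sigma1 Wgauge) -mulmxDl.
by rewrite /E addrC subrK.
Qed.

Lemma energyQ_le t : energyQ t <= 2 * opnorm LD ^+ 2 * (energyD t + energyE t).
Proof.
rewrite /energyQ QE; apply: (le_trans (frob_opnormr _ _)).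
rewrite (gauged_laplacian_sym Wsym sigma1 Wgauge).
apply: (le_trans (ler_wpM2l (sqr_ge0 _) (frobD_le _ _))).
by rewrite le_eqVlt; apply/orP; left; apply/eqP; rewrite /energyD /energyE; ring.
Qed.

Lemma centered_derive s b :
  mx_derive s 0 b Z (fun t => A *m Z t - B *m K *m Q t) ->
  mx_derive s 0 b D (fun t => A *m D t - B *m K *m ((D t + E t) *m LD)).
Proof.
move=> /(mx_derive_mulr centering); apply: eq_mx_derive => [//|t _ _].
have Qc : Q t *m centering = Q t.
  by rewrite /Q -mulmxA (laplacian_centering Wsym sigma1 Wgauge).
by rewrite mulmxBl -QE -(mulmxA A) -(mulmxA (B *m K)) Qc.
Qed.

Lemma lyapunov_budget t : 0 <= t ->
  bet * primitive 0 energyD t <= frob (D 0) (P *m D 0) + primitive 0 energyE t / c.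
Proof.
move=> t0; have [s [dZ cZh]] := closed_loop_on t0.
have [cE _ cD _] := energies_pw_continuous t0 dZ cZh.
have dD := centered_derive dZ.
have dV := pw_derive_frob dD (mx_derive_mull P dD).
have dF := pw_deriveD (pw_deriveZ (- bet) (pw_derive_primitive t0 cD))
  (pw_deriveZ c^-1 (pw_derive_primitive t0 cE)).
have := pw_derive_le t0 dV dF.
rewrite !primitive_start !mulr0 addr0 subr0 => H.
have V0 : 0 <= frob (D t) (P *m D t) by exact: posdef_frob.
suff : frob (D t) (P *m D t) - frob (D 0) (P *m D 0) <=
    - bet * primitive 0 energyD t + c^-1 * primitive 0 energyE t by lra.
apply: H => r _ _; rewrite [c^-1 * _]mulrC.
apply: (lyapunov_decay Wsym Wconn sigma1 Wgauge alphaP Ppos riccati c0) => // l.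
exact: centering_sum0.
Qed.

(** Writing e and d for the energies of the error and of the disagreement, the
    budgets read e <= r (d + e) + const and bet c d <= const + e. Eliminating e
    leaves d with the coefficient den, positive by the bound on beta_max. *)
Lemma energy_bounded : exists C, forall t, 0 <= t -> G t <= C.
Proof.
pose l2 := opnorm LD ^+ 2; pose r := 2 * l2 * beta_max.
pose V0 := frob (D 0) (P *m D 0); pose Sb := \sum_i beta i.
have bm0 : 0 <= beta_max by exact: bigmax_ge_id.
have l20 : 0 < l2.
  rewrite lt_neqAle sqr_ge0 andbT; apply/eqP => /esym l20.
  by move: beta_small; rewrite -/l2 l20 mulr0 invr0 mulr0 lt_min ltNge bm0.
have bc0 : 0 < bet * c by rewrite mulr_gt0.
have dl2 : 0 < 2 * l2 by rewrite pmulr_rgt0.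
have dbc : 0 < 2 * l2 * (bet * c + 1) by rewrite pmulr_rgt0// addr_gt0.
have [r1 rbc] : r < 1 /\ r * (bet * c + 1) < bet * c.
  move: beta_small; rewrite -/l2 lt_min (ltr_pdivlMr _ _ dl2) (ltr_pdivlMr _ _ dbc).
  by rewrite /r => /andP[H1 H2]; split; lra.
have r0 : 0 <= r by rewrite /r pmulr_rge0.
pose den := bet * c - r * (bet * c + 1).
have den0 : 0 < den by rewrite subr_gt0.
pose C1 := ((1 - r) * c * V0 + Sb) / den.
exists (C1 + (r * C1 + Sb) / (1 - r)) => t t0.
have [s [dZ cZh]] := closed_loop_on t0.
have [cE cQ cD _] := energies_pw_continuous t0 dZ cZh.
rewrite /G; set pD := primitive 0 energyD t; set pE := primitive 0 energyE t.
set pQ := primitive 0 energyQ t.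
have pQ_le : pQ <= 2 * l2 * (pD + pE).
  have dDE := pw_deriveZ (2 * l2) (pw_deriveD (pw_derive_primitive t0 cD)
    (pw_derive_primitive t0 cE)).
  have := pw_derive_le t0 (pw_derive_primitive t0 cQ) dDE.
  rewrite !primitive_start addr0 mulr0 !subr0; apply => u _ _; exact: energyQ_le.
have nb : pE <= r * (pD + pE) + Sb.
  apply: (le_trans (network_budget t0)); rewrite lerD2r /r [2 * l2 * _]mulrC -mulrA.
  by rewrite ler_wpM2l.
have lb : bet * c * pD <= c * V0 + pE.
  have := ler_wpM2l (ltW c0) (lyapunov_budget t0); rewrite -/pD -/pE -/V0.
  rewrite mulrDr [c * (pE / c)]mulrC divfK ?gt_eqF//.
  by rewrite mulrA [c * bet]mulrC.
have pD_le : pD <= C1.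
  rewrite ler_pdivlMr// /den.
  have := ler_wpM2l (ltW (_ : 0 < 1 - r)) lb; rewrite subr_gt0 => /(_ r1).
  lra.
rewrite lerD// ler_pdivlMr ?subr_gt0//.
have := ler_wpM2l r0 pD_le; lra.
Qed.

(** The energies dominate both the disagreement and its growth rate, so the
    disagreement at time t is bounded by the energy spent during the last unit
    of time. *)
Lemma disagreement_le : exists2 C, 0 < C & forall t, 1 <= t ->
  energyD t <= C * (G t - G (t - 1)).
Proof.
pose L := growth_rate A + 2 * opnorm (B *m K) ^+ 2 * opnorm LD ^+ 2.
have L0 : 0 < L.
  by rewrite ltr_wpDr ?growth_rate_gt0// mulr_ge0 ?sqr_ge0// mulr_ge0 ?sqr_ge0.
exists (1 + L); first by rewrite addr_gt0.
move=> t t1.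
have t0 : 0 <= t by rewrite (le_trans ler01).
have [s [dZ cZh]] := closed_loop_on t0.
have [cE _ cD _] := energies_pw_continuous t0 dZ cZh.
have dD := centered_derive dZ.
have dphi := pw_derive_frob dD dD.
have dG := pw_deriveD (pw_derive_primitive t0 cD) (pw_derive_primitive t0 cE).
have dpD := pw_derive_primitive t0 cD.
have t10 : 0 <= t - 1 by rewrite subr_ge0.
have tt1 : t - 1 <= t by rewrite gerBl.
have growth u : t - 1 <= u <= t -> energyD t <= energyD u + L * (G t - G (t - 1)).
  move=> /andP[t1u ut]; have u0 := le_trans t10 t1u.
  have := pw_derive_le ut (pw_deriveW u0 (lexx t) dphi) (pw_deriveZ L (pw_deriveW u0 (lexx t) dG)).
  move=> H; rewrite -lerBlDl; apply: (@le_trans _ _ (L * G t - L * G u)).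
    apply: H => w /andP[uw wt] _.
    have := frob_linear_derive A (B *m K) (D w) (- ((D w + E w) *m LD)).
    rewrite mulmxN => /le_trans; apply; rewrite frobNl frobNr opprK -QE.
    have := ler_wpM2l (sqr_ge0 (opnorm (B *m K))) (energyQ_le w).
    have := mulr_ge0 (ltW (growth_rate_gt0 A)) (frob_ge0 (E w)).
    rewrite /L -/(energyD w) -/(energyE w) -/(energyQ w); lra.
  rewrite -mulrBr ler_wpM2l ?(ltW L0)// lerD2l lerN2 lerD//.
    by apply: (primitive_ge0_le cD) => // ? _; exact: frob_ge0.
  by apply: (primitive_ge0_le cE) => // ? _; exact: frob_ge0.
pose k := energyD t - L * (G t - G (t - 1)).
have dk : pw_derive s (t - 1) t (fun u => k * u) (fun u => k * 1).
  by apply: pw_deriveZ; apply: is_derive_pw_derive => u; exact: is_derive_id.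
(* The bound on growth holds for every u in [t - 1, t]: average it over u. *)
have := pw_derive_le tt1 dk (pw_deriveW t10 (lexx t) dpD).
rewrite mulrBr => H.
have : k <= primitive 0 energyD t - primitive 0 energyD (t - 1).
  have kE : k = k * t - (k * t - k * 1) by ring.
  rewrite {1}kE; apply: H => u /andP[tu ut] _.
  by rewrite mulr1 lerBlDr growth// (ltW tu) (ltW ut).
have : primitive 0 energyE (t - 1) <= primitive 0 energyE t.
  by apply: (primitive_ge0_le cE) => // ? _; exact: frob_ge0.
rewrite /k /G; lra.
Qed.

Lemma energy_nondecreasing u t : 0 <= u -> u <= t -> G u <= G t.
Proof.
move=> u0 ut; have t0 := le_trans u0 ut.
have [s [dZ cZh]] := closed_loop_on t0.
have [cE _ cD _] := energies_pw_continuous t0 dZ cZh.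
by rewrite lerD//; [apply: (primitive_ge0_le cD)|apply: (primitive_ge0_le cE)] => // ? _;
  exact: frob_ge0.
Qed.

(** The spent energy G is nondecreasing and bounded, so its increments over
    unit intervals tend to zero. *)
Lemma disagreement_vanishes (eps : R) : 0 < eps ->
  exists2 t0, 1 <= t0 & forall t, t0 <= t -> energyD t < eps.
Proof.
move=> eps0; have [Cb Cb_ub] := energy_bounded; have [C C0 dis] := disagreement_le.
pose S := [set G u | u in [set u | 0 <= u]].
have Sub : has_ubound S by exists Cb => _ [u /= u0 <-]; exact: Cb_ub.
have Ssup : has_sup S by split => //; exists (G 0), 0 => /=.
have [_ [u /= u0 <-] uS] := sup_adherent (divr_gt0 eps0 C0) Ssup.
exists (u + 1); first by rewrite lerDr.
move=> t ut; have t1 : 1 <= t by rewrite (le_trans _ ut)// lerDr.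
have t0 : 0 <= t by rewrite (le_trans ler01).
apply: (le_lt_trans (dis t t1)); rewrite mulrC -ltr_pdivlMr//.
have GtS : G t <= sup S by apply: ub_le_sup => //; exists t.
have Gu : G u <= G (t - 1) by apply: energy_nondecreasing => //; rewrite lerBrDr.
lra.
Qed.

Lemma pair_disagreement_le i j t : l2norm (sigma i *: x i t - sigma j *: x j t) ^+ 2 <= 4 * energyD t.
Proof.
rewrite l2norm_sqr -!col_gauged.
have -> : col i (gauged sigma x t) - col j (gauged sigma x t) = col i (D t) - col j (D t).
  apply/matrixP => l k; rewrite !mxE -/(Z t).
  have := mulmx_centeringE (Z t) l i; have := mulmx_centeringE (Z t) l j.
  by rewrite !mxE => -> ->; ring.
have le a : frob (col a (D t)) (col a (D t)) <= energyD t.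
  by rewrite /energyD [leRHS]frob_col (bigD1 a)//= lerDl sumr_ge0// => b _; exact: frob_ge0.
by apply: (le_trans (frobB_le _ _)); have := le i; have := le j; lra.
Qed.

Lemma consensus : bipartite_consensus sigma x.
Proof.
move=> i j; apply/cvgrPdist_lt => eps eps0.
have [t0 t01 vanish] := disagreement_vanishes (divr_gt0 (exprn_gt0 2 eps0) (ltr0Sn R 3)).
near=> t; rewrite sub0r normrN ger0_norm ?l2norm_ge0//.
rewrite -(@ltr_pXn2r _ 2%N) ?nnegrE ?l2norm_ge0 ?(ltW eps0)//.
apply: (le_lt_trans (pair_disagreement_le i j t)).
rewrite mulrC -ltr_pdivlMr//; apply: vanish.
by near: t; apply: nbhs_pinfty_ge; exact: num_real.
Unshelve. all: by end_near. Qed.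

End Consensus.

Theorem mainTheorem1 (R : realType) (N n m : nat)
    (A : 'M[R]_n) (B : 'M[R]_(n, m)) (W : 'M[R]_N)
    (sigma beta : 'I_N -> R) (h : R -> R)
    (P : 'M[R]_n) (alpha kappa c : R)
    (T : instants R N) (x : signal R N n) :
  let K := B^T *m P in
  let L_D := gauged_laplacian W sigma in
  let beta_max := \big[Num.max/0]_i beta i in
  let bet := kappa - c * opnorm (L_D *t (P *m B *m B^T *m P)) ^+ 2 in
  (2 <= N)%N ->
  stabilizable A B ->
  signed_graph W ->
  graph_connected W ->
  structurally_balanced W ->
  (forall i, sigma i = 1 \/ sigma i = -1) ->
  (forall i j, 0 <= (gauge_mx sigma *m W *m gauge_mx sigma) i j) ->
  smallest_pos_eigenvalue (laplacian W) alpha ->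
  {within `[0, +oo[, continuous h} ->
  (forall s, 0 <= s -> 0 < h s) ->
  (\int[lebesgue_measure]_(s in `[0%R, +oo[) (h s)%:E = 1)%E ->
  0 < kappa ->
  posdefmx P ->
  posdefmx (- kappa%:M - (A^T *m P + P *m A - alpha *: (P *m B *m B^T *m P))) ->
  (forall i, 0 < beta i) ->
  0 < c ->
  0 < bet ->
  beta_max < Num.min (1 / (2 * opnorm L_D ^+ 2))
                     (bet * c / (2 * opnorm L_D ^+ 2 * (bet * c + 1))) ->
  event_triggered A B K W sigma beta h T x ->
  bipartite_consensus sigma x /\ positive_MIET T.
Proof.
move=> K L_D beta_max bet _ _ [Wsym _] Wconn _ sigma1 Wgauge alphaP hcont h0 hint _ Ppos ric
  beta0 c0 bet0 beta_small Tx; split.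
  exact: (consensus Wsym Wconn sigma1 Wgauge alphaP hcont h0 hint Ppos ric beta0 c0 bet0 beta_small Tx).
have [tau tau0 Ttau] := min_inter_event Wsym sigma1 Wgauge hcont h0 beta0 Tx.
exists tau => // i k Tk; have Twt := event_well_timed Tx i.
have TE : T i k \is a fin_num.
  by rewrite fin_numElt Tk (lt_le_trans _ (instant_ge0 Twt k)) ?ltNy0.
by rewrite leeBrDl// Ttau.
Qed.
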